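(* Let $d$ be a positive integer. Let $\alpha$ be a real algebraic number of degree $d+1$ and denote by $r$ the unit rank of $\mathbf{Q}(\alpha)$. Let $p$ be a prime number. There exist positive constants $c_1, c_2, c_3$ and infinitely many real algebraic numbers $\xi$ of degree $d$ such that $$|\alpha-\xi| < c_1 H(\xi)^{-d-1},$$ $$|\xi|_v < c_2 (\log 3H(\xi))^{-1/(rd)}$$ for every absolute value $|\cdot|_v$ on $\mathbf{Q}(\xi)$ above the prime $p$, and $$|\alpha-\xi|\cdot\min\{|\mathrm{Norm}(\xi)|_p,1\} < c_3 H(\xi)^{-d-1}(\log 3H(\xi))^{-1/r}.$$
   Context: The height $H(P)$ of an integer polynomial $P(X)$ is the maximum of the absolute values of its coefficients. For an algebraic number $\xi$ of degree $d$ with minimal defining polynomial over the rational integers $a_0+a_1X+\dots+a_dX^d$ (irreducible, with coprime integer coefficients), the height $H(\xi)$ is the height of this polynomial, and $\mathrm{Norm}(\xi)$ is the rational number $(-1)^d a_0/a_d$. Here $\log 3H(\xi)$ means $\log(3H(\xi))$. The $p$-adic absolute value $|\cdot|_p$ on $\mathbf{Q}$ is normalized by $|p|_p=p^{-1}$. For a number field $\mathbf{K}$ and a non-Archimedean place $v$ of $\mathbf{K}$ above $p$, the absolute value $|\cdot|_v$ is normalized so that it coincides with $|\cdot|_p$ on $\mathbf{Q}$. The unit rank of a number field is the rank of the unit group of its ring of integers. *)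

(* Defs.v *)
From HB Require Import structures.
From mathcomp Require Import all_boot all_order all_algebra.
From mathcomp Require Import all_classical all_reals all_analysis.

Set Implicit Arguments.
Unset Strict Implicit.
Unset Printing Implicit Defensive.

Import Order.TTheory GRing.Theory Num.Theory.

Local Open Scope classical_set_scope.
Local Open Scope ring_scope.

Section AlgebraicNumbers.
Variable R : realType.
Implicit Types (x y : R) (P : {poly int}).

(* [zcontents P] carries the sign of the leading coefficient, so content 1
   means coprime coefficients together with a positive leading coefficient;
   this makes [P] unique. For such [P], irreducibility over the integers and
   over the rationals coincide (Gauss). *)
Definition is_defining_poly x P : Prop :=
  [/\ zcontents P = 1,
      irreducible_poly (map_poly intr P : {poly rat}) &
      root (map_poly intr P) x].

(* The value 0 is taken when [x] is transcendental. *)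
Definition defining_poly x : {poly int} := xget 0 [set P | is_defining_poly x P].

Definition alg_degree x : nat := (size (defining_poly x)).-1.

Definition algebraic_of_degree (d : nat) x : Prop :=
  algebraicOver (ratr : rat -> R) x /\ alg_degree x = d.

Definition poly_height P : nat := (\max_(i < size P) `|(P`_i)%R|)%N.

Definition height x : nat := poly_height (defining_poly x).

Definition Norm x : rat :=
  (-1) ^+ alg_degree x * ((defining_poly x)`_0)%:~R
    / (lead_coef (defining_poly x))%:~R.

Definition padic_abs (p : nat) (q : rat) : R :=
  if q == 0 then 0
  else p%:R ^ ((logn p `|denq q|%N)%:Z - (logn p `|numq q|%N)%:Z).

(* Q(x) as a subset of R. *)
Definition Qadjoin x : set R :=
  [set y | exists f g : {poly rat},
     (map_poly ratr g).[x] != 0 /\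
     y = (map_poly ratr f).[x] / (map_poly ratr g).[x]].

Definition ring_of_integers (K : set R) : set R :=
  [set y | K y /\ integralOver (intr : int -> R) y].

Definition integer_units (K : set R) : set R :=
  [set u | [/\ u != 0, ring_of_integers K u & ring_of_integers K u^-1]].

Definition mult_independent (n : nat) (u : 'I_n -> R) : Prop :=
  forall e : 'I_n -> int, \prod_(i < n) u i ^ e i = 1 -> forall i, e i = 0.

(* The rank of the abelian group [integer_units K]: the largest size of a
   family of elements that is linearly independent over the integers. *)
Definition unit_rank (K : set R) (r : nat) : Prop :=
  (exists u : 'I_r -> R,
     (forall i, integer_units K (u i)) /\ mult_independent u) /\
  (forall n (u : 'I_n -> R),
     (forall i, integer_units K (u i)) -> mult_independent u -> (n <= r)%N).

(* Only the values of [v] on [K] matter. *)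
Definition absval_above (p : nat) (K : set R) (v : R -> R) : Prop :=
  [/\ forall y, K y -> 0 <= v y,
      forall y, K y -> (v y = 0 <-> y = 0),
      forall y z, K y -> K z -> v (y * z) = v y * v z,
      forall y z, K y -> K z -> v (y + z) <= Num.max (v y) (v z) &
      forall q : rat, v (ratr q) = padic_abs p q].

End AlgebraicNumbers.

Arguments padic_abs : clear implicits.

(* Main.v *)
(** Let M be the lattice spanned by 1, alpha, ..., alpha^d, and O the order of
    multipliers of M.  If u is a unit of O congruent to 1 modulo p^s, then
    u alpha^d = P(alpha) for an integer polynomial P congruent to X^d modulo
    p^s.  If moreover u has size H^-d at the given real embedding of Q(alpha),
    and all its other conjugates are close to one and the same real number H,
    then P / H is close, coefficient by coefficient, to a fixed polynomial Q with
    Q(alpha) = 0, Q'(alpha) <> 0 and Q(0) <> 0.  Hence P has a real root xi with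
    |alpha - xi| = O(H^(-d-1)), and all the roots of P are p-adically small.

    Such units are found by a double application of the box principle.
    Dirichlet's box principle in M gives, for every t, a unit whose conjugates
    have size 2^t except for the given one, of size 2^(-dt); consecutive units
    have a bounded, hence finite, set of quotients, so that fixed powers of all
    of them lie in a group generated by at most r units u_j.  As the order of
    each u_j modulo p^s is O(p^s), among O(p^(sr)) such units two are congruent
    modulo p^s and have proportional conjugates up to a small error; their
    quotient is the unit u, and log H = O(p^(sr)).

    Finally P is irreducible for large s: if P = F G with F(xi) = 0, the lower
    bound for the norm of F(alpha) shows that the conjugates of F(alpha) are as
    large as those of P(alpha), so that G is bounded.  But P = X^d modulo p^s
    forces p^s to divide G(0)^d when G is not constant, while G(0) <> 0. *)

Require Import Defs.
From HB Require Import structures.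
From mathcomp Require Import all_boot all_order all_algebra.
From mathcomp Require Import all_classical all_reals all_analysis.
From mathcomp Require Import all_field complex.
From mathcomp Require Import zify ring lra.

Set Implicit Arguments.
Unset Strict Implicit.
Unset Printing Implicit Defensive.

Import Order.TTheory GRing.Theory Num.Theory.

Local Open Scope classical_set_scope.
Local Open Scope ring_scope.

(** * Finite sums, cells of an interval and the box principle *)

Lemma ler_term_sum (R : numDomainType) (I : finType) (F : I -> R) i :
  (forall j, 0 <= F j) -> F i <= \sum_j F j.
Proof. by move=> F0; rewrite (bigD1 i) //= lerDl sumr_ge0. Qed.

Section Cells.
Variables (R : realType) (A : R) (M : nat).
Hypothesis M_gt0 : (0 < M)%N.

(** Number of the piece containing [y] when the interval from [-A] to [A] is cut into [M] pieces of
    length [2 A / M]. *)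
Definition cell (y : R) : nat := Num.truncn ((y + A) / (2 * A) * M%:R).

Lemma cell_lt y : `|y| < A -> (cell y < M)%N.
Proof.
rewrite ltr_norml => /andP[Ay yA]; have A0 : 0 < 2 * A by lra.
rewrite /cell truncn_lt_nat.
  by rewrite gtr_pMl ?ltr0n // ltr_pdivrMr // mul1r; lra.
by rewrite mulr_ge0 // divr_ge0 //; lra.
Qed.

Lemma cell_eq y y' : `|y| < A -> `|y'| < A -> cell y = cell y' ->
  `|y - y'| <= 2 * A / M%:R.
Proof.
move=> yA y'A eqc.
have A0 : 0 < 2 * A by rewrite mulr_gt0 // (le_lt_trans _ yA).
have M0 : 0 < M%:R :> R by rewrite ltr0n.
have pos u : `|u| < A -> 0 <= (u + A) / (2 * A) * M%:R.
  by rewrite ltr_norml => /andP[Au uA]; rewrite mulr_ge0 // divr_ge0 //; lra.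
have /andP[l1 u1] := truncn_itv (pos _ yA).
have /andP[l2 u2] := truncn_itv (pos _ y'A).
rewrite -/(cell y) eqc -[(cell y').+1%:R]natr1 in l1 u1.
rewrite -/(cell y') -[(cell y').+1%:R]natr1 in l2 u2.
rewrite ler_pdivlMr // -[leRHS]mul1r -ler_pdivrMr //.
set a := (X in X <= 1); have -> : a = `|(y + A) / (2 * A) * M%:R - (y' + A) / (2 * A) * M%:R|.
  rewrite -mulrBl -mulrBl opprD addrACA subrr addr0 !normrM.
  by rewrite normfV (gtr0_norm A0) (gtr0_norm M0) /a mulrAC.
by rewrite ler_norml; lra.
Qed.

End Cells.

Lemma exists_collision (T T' : finType) (h : T -> T') :
  (#|T'| < #|T|)%N -> exists t t', t != t' /\ h t = h t'.
Proof.
move=> ltT; have : ~~ injectiveb h.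
  by apply: contraTN ltT => /injectiveP /leq_card; rewrite leqNgt.
by case/injectivePn => t [t' ne e]; exists t, t'.
Qed.

(** The point is the uniform bound [m]: an object of arbitrary index [t] can be compared with one of
    the same class and of bounded index. *)
Lemma finite_representatives (T : finType) (h : nat -> T) :
  exists m, forall t, exists2 t', (t' <= m)%N & h t' = h t.
Proof.
have [g Hg] : {g : T -> nat & forall x, (exists t, h t = x) -> h (g x) = x}.
  apply: (@choice _ _ (fun x n => (exists t, h t = x) -> h n = x)) => x.
  by have [[t htx]|nx] := pselect (exists t, h t = x); [exists t | exists 0].
exists (\max_x g x)%N => t; exists (g (h t)); last by apply: Hg; exists t.
exact: leq_bigmax.
Qed.

(** The [n] other factors contribute at most [C ^ n] to the product. *)
Lemma prod_lower_bound (R : realFieldType) (n : nat) (x : 'I_n.+1 -> R) (c C : R) i :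
  0 < C -> (forall j, 0 <= x j <= C) -> c <= \prod_j x j -> c / C ^+ n <= x i.
Proof.
move=> C0 xC cx; rewrite ler_pdivrMr ?exprn_gt0 //; apply: le_trans cx _.
have /andP[xi0 _] := xC i; rewrite (bigD1 i) //= ler_wpM2l //.
apply: le_trans (_ : _ <= \prod_(j | j != i) C) _.
  exact: ler_prod.
by rewrite prodr_const cardC1 card_ord.
Qed.

(** * Multiplicative ranks *)

Section MultiplicativeSpan.
Variable R : realType.

Definition mult_span n (u : 'I_n -> R) : set R :=
  [set x | exists c : 'I_n -> int, x = \prod_i u i ^ c i].

Lemma mult_spanM n (u : 'I_n -> R) x y : (forall i, u i != 0) ->
  mult_span u x -> mult_span u y -> mult_span u (x * y).
Proof.
move=> u0 [c ->] [e ->]; exists (fun i => c i + e i).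
by rewrite -big_split; apply: eq_bigr => i _; rewrite expfzDr.
Qed.

Lemma mult_spanXz n (u : 'I_n -> R) x (m : int) : mult_span u x -> mult_span u (x ^ m).
Proof.
move=> [c ->]; exists (fun i => c i * m).
rewrite (big_morph (fun y : R => y ^ m) (fun x y => expfzMl x y m) (exp1rz _ m)).
by apply: eq_bigr => i _; rewrite exprz_exp.
Qed.

(** In a nontrivial relation between [x] and the [u j], the exponent of [x] cannot vanish, since [u]
    is independent. Solving for [x] puts a power of it in the span. *)
Lemma mult_span_exchange n (u : 'I_n -> R) (x : R) :
  (forall i, u i != 0) -> x != 0 -> mult_independent u ->
  let v := fun i => if unlift ord0 i is Some j then u j else x in
  mult_independent v \/ exists2 m : nat, (0 < m)%N & mult_span u (x ^+ m).
Proof.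
move=> u0 x0 indu v; have [|nindv] := pselect (mult_independent v); first by left.
right; have [e [prode nze]] : exists e : 'I_n.+1 -> int,
    \prod_i v i ^ e i = 1 /\ ~ (forall i, e i = 0).
  apply: contrapT => H; apply: nindv => e prode; apply: contrapT => nz.
  by apply: H; exists e.
move: prode; rewrite big_ord_recl {1}/v unlift_none.
under eq_bigr => i _ do rewrite /v liftK.
move=> prode.
have e0 : e ord0 != 0.
  apply/eqP => e0; apply: nze => i; have [j ->|->//] := unliftP ord0 i.
  by move: prode; rewrite e0 expr0z mul1r => /indu.
have sx : mult_span u (x ^ e ord0).
  exists (fun i => - e (lift ord0 i)).
  have nz : \prod_i u i ^ e (lift ord0 i) != 0.
    by apply/prodf_neq0 => i _; rewrite expfz_neq0.
  apply: (mulIf nz); rewrite prode -big_split big1 // => i _.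
  by rewrite /= -expfzDr // addNr expr0z.
exists `|e ord0|%N; first by rewrite absz_gt0.
rewrite exprnP abszE.
case: ger0P => _; first exact: sx.
by rewrite -mulrN1 -exprz_exp; apply: mult_spanXz.
Qed.

(** The elements of [F] are added one at a time: an independent one enlarges the family, a dependent
    one only multiplies the common exponent [N]. *)
Lemma maximal_independent (F : seq R) : (forall x, x \in F -> x != 0) ->
  exists n (u : 'I_n -> R) (N : nat), [/\ forall i, u i \in F,
    mult_independent u, (0 < N)%N & forall x, x \in F -> mult_span u (x ^+ N)].
Proof.
elim: F => [_|x F IHF F0].
  exists 0, (fun=> 1), 1; split=> //; first by case.
  by move=> e _ [].
have [|n [u [N [uF indu N0 spu]]]] := IHF.
  by move=> y yF; apply: F0; rewrite inE yF orbT.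
have u0 i : u i != 0 by apply: F0; rewrite inE uF orbT.
have x0 : x != 0 by apply: F0; rewrite inE eqxx.
have [indv|[m m0 spx]] := mult_span_exchange u0 x0 indu; last first.
  exists n, u, (N * m)%N; split=> [i||//|y].
  - by rewrite inE uF orbT.
  - exact: indu.
  - by rewrite muln_gt0 N0.
  rewrite inE => /predU1P[->|yF].
    by rewrite mulnC exprM exprnP; apply: mult_spanXz.
  by rewrite exprM exprnP; apply: mult_spanXz; apply: spu.
set v := (fun _ => _) in indv; exists n.+1, v, N; split=> // [i|y].
  rewrite /v; case: unliftP => [j _|_]; first by rewrite inE uF orbT.
  by rewrite inE eqxx.
rewrite inE => /predU1P[->|/spu[c ->]].
  exists (fun i => if unlift ord0 i is Some j then 0 else N%:Z).
  rewrite big_ord_recl /v unlift_none big1 ?mulr1 // => i _.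
  by rewrite liftK.
exists (fun i => if unlift ord0 i is Some j then c j else 0).
rewrite big_ord_recl /v unlift_none expr0z mul1r.
by apply: eq_bigr => i _; rewrite liftK.
Qed.

End MultiplicativeSpan.

(** * Integer matrices modulo prime powers *)

Section Congruences.
Variable d : nat.
Implicit Types (E F Y : 'M[int]_d.+1) (q : int).

Definition mx_cong1 q E := exists Y, E = 1 + q *: Y.

Lemma mx_cong1_1 q : mx_cong1 q 1.
Proof. by exists 0; rewrite scaler0 addr0. Qed.

Lemma mx_cong1M q E F : mx_cong1 q E -> mx_cong1 q F -> mx_cong1 q (E * F).
Proof.
move=> [Y ->] [Y' ->]; exists (Y + (1 + q *: Y) * Y').
by rewrite mulrDr mulr1 -addrA scalerDr scalerAr.
Qed.

Lemma mx_cong1V q E : E \is a GRing.unit -> mx_cong1 q E -> mx_cong1 q E^-1.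
Proof.
move=> uE [Y defE]; exists (- (E^-1 * Y)); apply: (mulrI uE).
by rewrite divrr // mulrDr mulr1 scalerN mulrN -scalerAr mulrA divrr // mul1r {1}defE addrK.
Qed.

Lemma mx_cong1X q E n : mx_cong1 q E -> mx_cong1 q (E ^+ n).
Proof.
move=> qE; elim: n => [|n IHn]; first exact: mx_cong1_1.
by rewrite exprS; apply: mx_cong1M.
Qed.

(** [E ^ p - 1] is the product of [E - 1], divisible by [q], and of the sum of the [E ^ i] for
    [i < p]. Each term of the sum is 1 modulo [q], so the sum is [p] modulo [q], hence divisible by
    [p] because [p] divides [q]. *)
Lemma mx_cong1_lift (p : nat) q E : (p%:Z %| q)%Z -> mx_cong1 q E ->
  mx_cong1 (q * p%:Z) (E ^+ p).
Proof.
move=> /dvdzP[q' defq] qE; have [Y defE] := qE.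
have [Y' HY'] := choice (fun i => mx_cong1X i qE).
exists (Y * (1 + q' *: \sum_(i < p) Y' i)); apply/eqP; rewrite addrC -subr_eq; apply/eqP.
rewrite subrX1 {1}defE [1 + _]addrC addrK.
under [\sum_(i < p) E ^+ i]eq_bigr => i _ do rewrite HY'.
rewrite big_split /= sumr_const card_ord -scaler_sumr defq.
rewrite -scalerAl -[RHS]scalerA; congr (_ *: _); rewrite scalerAr; congr (_ * _).
by rewrite scalerDr scalerA [p%:Z * q']mulrC -natz scaler_nat.
Qed.

(* ['I_L.+1] rather than ['I_L], so that [inord] applies; the value L is never taken. *)
Definition residue_mx (L : nat) E : 'M['I_L.+1]_d.+1 :=
  \matrix_(k, l) inord `|(E k l %% L%:Z)%Z|%N.

Lemma residue_mx_eq (L : nat) E F : (0 < L)%N -> residue_mx L E = residue_mx L F ->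
  exists Y, F = E + L%:Z *: Y.
Proof.
move=> L0 eqEF; have L0' : L%:Z != 0 by rewrite gt_eqF.
exists (\matrix_(k, l) ((F k l - E k l) %/ L%:Z)%Z).
apply/matrixP => k l; rewrite !mxE mulrC divzK; first by rewrite addrC subrK.
rewrite -eqz_mod_dvd; apply/eqP; move/matrixP/(_ k l)/(congr1 val): eqEF.
have lt (m : int) : (`|(m %% L%:Z)%Z| < L.+1)%N.
  by rewrite ltnW // ltnS -ltz_nat gez0_abs ?modz_ge0 // ltz_pmod.
rewrite !mxE /= !inordK // => e.
by rewrite -[LHS]gez0_abs ?modz_ge0 // -[RHS]gez0_abs ?modz_ge0 // e.
Qed.

(** The powers of [E] fall into finitely many classes modulo [p]; two congruent powers are divided
    by the smaller one. *)
Lemma mx_cong1_order (p : nat) E : (0 < p)%N -> E \is a GRing.unit ->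
  exists2 m, (0 < m)%N & mx_cong1 p%:Z (E ^+ m).
Proof.
move=> p0 uE; have [t [t' [lt eqcls]]] : exists t t',
    (t < t')%N /\ residue_mx p (E ^+ t) = residue_mx p (E ^+ t').
  have [|t [t' [ne eqcls]]] := @exists_collision 'I_(#|{: 'M['I_p.+1]_d.+1}|).+1 _
      (fun t => residue_mx p (E ^+ t)); first by rewrite card_ord.
  case: (ltngtP t t') => [lt|lt|e]; [by exists t, t'|by exists t', t|].
  by case/eqP: ne; apply: val_inj.
have [Y EY] := residue_mx_eq p0 eqcls; have uEt := unitrX t uE.
exists (t' - t)%N; rewrite ?subn_gt0 //; exists (E ^- t * Y).
rewrite -[LHS](mulKr uEt) -exprD subnKC; last exact: ltnW.
by rewrite EY mulrDr mulVr // scalerAr.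
Qed.

(** Each further factor [p] of the modulus costs one factor [p] in the exponent, so that the order
    modulo [p ^ s] is O([p ^ s]). This linear growth is the source of the exponent [r] in the bound
    for [ln H]. *)
Lemma mx_cong1_pow_order (p : nat) E : (0 < p)%N -> E \is a GRing.unit ->
  exists2 m, (0 < m)%N & forall s, mx_cong1 (p ^ s)%N%:Z (E ^+ (m * p ^ s)).
Proof.
move=> p0 uE; have [m m0 Em] := mx_cong1_order p0 uE; exists m => // s.
(* The induction runs with one more factor [p], since lifting requires a modulus divisible by [p],
   which [p ^ 0] is not. *)
suff [Y EY] : mx_cong1 (p ^ s.+1)%N%:Z (E ^+ (m * p ^ s)).
  by exists (p%:Z *: Y); rewrite EY scalerA -PoszM -expnSr.
elim: s => [|s IHs]; first by rewrite expn0 muln1 expn1.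
have -> : (m * p ^ s.+1 = m * p ^ s * p)%N by rewrite expnSr mulnA.
have -> : (p ^ s.+2)%N%:Z = (p ^ s.+1)%N%:Z * p%:Z by rewrite expnSr.
rewrite exprM; by apply: mx_cong1_lift => //; rewrite expnS PoszM dvdz_mulr.
Qed.

Lemma bounded_mx_finite (B : nat) : exists F : seq 'M[int]_d.+1,
  forall E, (forall k l, `|E k l| <= B%:Z) -> E \in F.
Proof.
exists [seq \matrix_(k, l) ((M k l : nat)%:Z - B%:Z) | M : 'M['I_(B + B).+1]_d.+1].
move=> E EB; apply/mapP; exists (\matrix_(k, l) inord `|(E k l + B%:Z)%R|%N); rewrite ?mem_enum //.
apply/matrixP => k l; rewrite !mxE inordK.
  by rewrite gez0_abs ?addrK //; have := EB k l; lia.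
by have := EB k l; lia.
Qed.

End Congruences.

(** * Moduli of complex numbers and interpolation *)

Section ComplexModulus.
Variable R : realType.
Implicit Types (x y : R[i]) (a : R).

(** The norm of [R[i]] takes its values in [R[i]]; this is the same modulus as an element of [R]. *)
Definition cabs x : R := complex.Re `|x|.

Lemma cabsE x : (cabs x)%:C%C = `|x|.
Proof. by rewrite /cabs normc_def. Qed.

Lemma cabs_ge0 x : 0 <= cabs x.
Proof. by rewrite -lecR cabsE normr_ge0. Qed.

Lemma cabsM x y : cabs (x * y) = cabs x * cabs y.
Proof. by apply: complexI; rewrite rmorphM /= !cabsE normrM. Qed.

Lemma cabsD x y : cabs (x + y) <= cabs x + cabs y.
Proof. by rewrite -lecR rmorphD /= !cabsE ler_normD. Qed.

Lemma cabsN x : cabs (- x) = cabs x.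
Proof. by apply: complexI; rewrite /= !cabsE normrN. Qed.

Lemma cabs_eq0 x : (cabs x == 0) = (x == 0).
Proof. by rewrite -(inj_eq (@complexI R)) cabsE normr_eq0. Qed.

Lemma cabs0 : cabs 0 = 0.
Proof. by apply/eqP; rewrite cabs_eq0. Qed.

Lemma cabs_gt0 x : (0 < cabs x) = (x != 0).
Proof. by rewrite lt_def cabs_ge0 andbT cabs_eq0. Qed.

Lemma cabs_real a : cabs a%:C%C = `|a|.
Proof. by apply: complexI; rewrite cabsE normc_def /= expr0n addr0 sqrtr_sqr. Qed.

Lemma cabs1 : cabs 1 = 1.
Proof. by rewrite -[1 in LHS](rmorph1 (real_complex R)) cabs_real normr1. Qed.

Lemma cabsV x : cabs x^-1 = (cabs x)^-1.
Proof. by apply: complexI; rewrite fmorphV /= !cabsE normfV. Qed.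

Lemma cabsX x n : cabs (x ^+ n) = cabs x ^+ n.
Proof. by elim: n => [|n IHn]; rewrite ?cabs1 // !exprS cabsM IHn. Qed.

Lemma cabs_int (m : int) : cabs m%:~R = `|m|%:~R.
Proof. by rewrite -(rmorph_int (real_complex R)) cabs_real intr_norm. Qed.

Lemma cabs_prod (I : finType) (P : pred I) (F : I -> R[i]) :
  cabs (\prod_(i | P i) F i) = \prod_(i | P i) cabs (F i).
Proof. by apply: (big_morph _ cabsM cabs1). Qed.

Lemma cabs_sum (I : finType) (P : pred I) (F : I -> R[i]) :
  cabs (\sum_(i | P i) F i) <= \sum_(i | P i) cabs (F i).
Proof.
elim/big_ind2: _ => [|x a y b xa yb|//]; first by rewrite cabs0.
exact: le_trans (cabsD _ _) (lerD xa yb).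
Qed.

Lemma cabs_le_ReIm x : cabs x <= `|complex.Re x| + `|complex.Im x|.
Proof.
rewrite [x in cabs x]complexE; apply: le_trans (cabsD _ _) _.
rewrite cabsM !cabs_real lerD2l.
suff -> : cabs 'i%C = 1 by rewrite mul1r.
by apply: complexI; rewrite cabsE normc_def /= expr0n add0r expr1n sqrtr1.
Qed.

Lemma Re_le_cabs x : `|complex.Re x| <= cabs x.
Proof. by rewrite -lecR cabsE normc_ge_Re. Qed.

Lemma Im_le_cabs x : `|complex.Im x| <= cabs x.
Proof.
rewrite -normrN -ReiNIm; apply: le_trans (Re_le_cabs _) _.
rewrite cabsM [cabs 'i%C](_ : _ = 1) ?mulr1 //.
by apply: complexI; rewrite cabsE normc_def /= expr0n add0r expr1n sqrtr1.
Qed.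

End ComplexModulus.

Lemma horner_deriv_bound (R : realType) (n : nat) (x : R[i]) : exists2 B : R, 0 < B &
  forall (P : {poly R[i]}) (c : R), (size P <= n)%N -> (forall k, cabs P`_k <= c) ->
    cabs P.[x] <= B * c /\ cabs P^`().[x] <= B * c.
Proof.
pose B1 := \sum_(k < n) cabs x ^+ k; pose B2 := \sum_(k < n) k.+1%:R * cabs x ^+ k.
have B10 : 0 <= B1 by apply: sumr_ge0 => k _; rewrite exprn_ge0 ?cabs_ge0.
have B20 : 0 <= B2 by apply: sumr_ge0 => k _; rewrite mulr_ge0 ?exprn_ge0 ?cabs_ge0.
exists (1 + B1 + B2) => [|P c szP Pc]; first by rewrite -addrA ltr_pwDl ?addr_ge0.
have c0 : 0 <= c by apply: le_trans (cabs_ge0 _) (Pc 0).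
split.
  rewrite (horner_coef_wide _ szP); apply: le_trans (cabs_sum _ _) _.
  apply: le_trans (_ : _ <= B1 * c) _; last by rewrite ler_wpM2r //; lra.
  rewrite mulr_suml; apply: ler_sum => k _.
  by rewrite cabsM cabsX mulrC ler_wpM2l ?exprn_ge0 ?cabs_ge0.
have szP' : (size P^`() <= n)%N.
  by rewrite (leq_trans (size_poly _ _)) // (leq_trans (leq_pred _)).
rewrite (horner_coef_wide _ szP'); apply: le_trans (cabs_sum _ _) _.
apply: le_trans (_ : _ <= B2 * c) _; last by rewrite ler_wpM2r //; lra.
rewrite mulr_suml; apply: ler_sum => k _.
rewrite coef_deriv cabsM cabsX -[P`_k.+1 *+ k.+1]mulr_natl cabsM.
have -> : cabs (k.+1%:R : R[i]) = k.+1%:R.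
  by rewrite -(rmorph_nat (real_complex R)) cabs_real ger0_norm.
by rewrite [leRHS]mulrAC ler_wpM2r ?exprn_ge0 ?cabs_ge0 // ler_wpM2l.
Qed.

(** Any [k] larger than the sum of the moduli of the roots will do. This provides integer points at
    which the limit polynomial does not vanish. *)
Lemma roots_bounded (R : realType) (Q : {poly R[i]}) : Q != 0 ->
  exists m : nat, forall k : nat, (m <= k)%N -> Q.[k%:R] != 0.
Proof.
move=> Q0; have [rs defQ] := closed_field_poly_normal Q.
exists (Num.truncn (\sum_(x <- rs) cabs x)).+1 => k lek.
apply: contraTneq lek => /eqP; rewrite -[_ == 0]/(root Q k%:R) defQ.
rewrite rootZ ?lead_coef_eq0 // root_prod_XsubC => krs.
rewrite -ltnNge ltnS truncn_ge_nat; last by rewrite sumr_ge0 // => *; apply: cabs_ge0.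
rewrite (big_rem _ krs) /= -(rmorph_nat (real_complex R)) cabs_real ger0_norm //.
by rewrite lerDl sumr_ge0 // => *; apply: cabs_ge0.
Qed.

Lemma exists_pos_lower_bound (R : realType) (I : finType) (F : I -> R) :
  (forall j, 0 < F j) -> exists2 c : R, 0 < c & forall j, c <= F j.
Proof.
move=> F0; exists (\sum_j (F j)^-1 + 1)^-1 => [|j].
  by rewrite invr_gt0 ltr_wpDl // sumr_ge0 // => j _; rewrite invr_ge0 ltW.
rewrite -[leRHS]invrK lef_pV2 ?posrE ?invr_gt0 //; last first.
  by rewrite ltr_wpDl // sumr_ge0 // => k _; rewrite invr_ge0 ltW.
apply: le_trans (ler_term_sum (F := fun j => (F j)^-1) j _) _; last by rewrite lerDl.
by move=> k; rewrite invr_ge0 ltW.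
Qed.

Lemma exists_upper_bound (R : realType) (I : finType) (F : I -> R) :
  exists2 c : R, 0 < c & forall j, F j <= c.
Proof.
exists (1 + \sum_j `|F j|) => [|j].
  by rewrite ltr_pwDl // sumr_ge0.
apply: le_trans (ler_norm _) _; rewrite ler_wpDl //.
exact: (ler_term_sum (F := fun j => `|F j|)).
Qed.

Lemma horner_points_bound (R : realType) (n : nat) (I : finType) (x : I -> R[i]) :
  exists2 B : R, 0 < B & forall (P : {poly R[i]}) b j, (size P <= n)%N ->
    (forall k, cabs P`_k <= b) -> cabs P.[x j] <= B * b.
Proof.
have /choice[Bf HBf] : forall j, exists B : R, 0 < B /\ forall (P : {poly R[i]}) b,
    (size P <= n)%N -> (forall k, cabs P`_k <= b) -> cabs P.[x j] <= B * b.
  move=> j; have [B B0 HB] := horner_deriv_bound n (x j).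
  by exists B; split=> // P b szP Pb; have [] := HB P b szP Pb.
have [B B0 HB] := exists_upper_bound Bf.
exists B => // P b j szP Pb; have [_ HBj] := HBf j.
apply: le_trans (HBj P b szP Pb) _.
by rewrite ler_wpM2r // (le_trans (cabs_ge0 _) (Pb 0)).
Qed.

Section Interpolation.
Variables (R : realType) (n : nat) (x : 'I_n.+1 -> R[i]).
Hypothesis x_inj : injective x.

Definition nodes_mx : 'M[R[i]]_n.+1 := Vandermonde n.+1 (\row_i x i).

Lemma nodes_mx_unit : nodes_mx \in unitmx.
Proof.
rewrite unitmxE unitfE det_Vandermonde; apply/prodf_neq0 => i _.
apply/prodf_neq0 => j ltij; rewrite !mxE subr_eq0 (inj_eq x_inj).
by apply: contraTneq ltij => ->; rewrite ltnn.
Qed.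

Lemma horner_nodes (P : {poly R[i]}) : (size P <= n.+1)%N ->
  poly_rV P *m nodes_mx = \row_i P.[x i].
Proof.
move=> szP; apply/rowP => i; rewrite !mxE (horner_coef_wide _ szP).
by apply: eq_bigr => k _; rewrite !mxE.
Qed.

(** Inverting the Vandermonde matrix recovers the coefficients from the values; [K] depends on the
    nodes only. *)
Lemma interp_bound : exists2 K : R, 0 < K &
  forall (P : {poly R[i]}) (M : R), (size P <= n.+1)%N ->
    (forall i, cabs P.[x i] <= M) -> forall k, cabs P`_k <= K * M.
Proof.
pose K := 1 + \sum_i \sum_k cabs (invmx nodes_mx i k).
have K0 : 0 <= \sum_i \sum_k cabs (invmx nodes_mx i k).
  by apply: sumr_ge0 => i _; apply: sumr_ge0 => k _; apply: cabs_ge0.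
exists K => [|P M szP PM k]; first by rewrite ltr_pwDl.
have [ltkn|lenk] := ltnP k n.+1; last first.
  rewrite nth_default ?(leq_trans szP) // cabs0 mulr_ge0 //.
    by rewrite addr_ge0.
  exact: le_trans (cabs_ge0 _) (PM ord0).
have -> : P`_k = (poly_rV P *m nodes_mx *m invmx nodes_mx) 0 (Ordinal ltkn).
  by rewrite mulmxK ?nodes_mx_unit // mxE.
rewrite horner_nodes // mxE.
apply: le_trans (cabs_sum _ _) _.
have M0 : 0 <= M by apply: le_trans (cabs_ge0 _) (PM (Ordinal ltkn)).
rewrite /K mulrDl mul1r ler_wpDl // mulr_suml; apply: ler_sum => i _.
rewrite cabsM mxE mulrC; apply: ler_pM; rewrite ?cabs_ge0 //.
by rewrite (bigD1 (Ordinal ltkn)) //= lerDl sumr_ge0 // => j _; apply: cabs_ge0.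
Qed.

End Interpolation.

(** * Integer matrices representing algebraic integers *)

Section Multipliers.
Variables (R : realType) (d : nat) (z : 'I_d.+1 -> R[i]).
Implicit Types (E F : 'M[int]_d.+1) (i : 'I_d.+1).

(* The integer matrices having all the columns (1, z_i, ..., z_i^d) as eigenvectors
   represent the multiplications by the elements of the order O; the eigenvalues
   are the conjugates of the element. *)
Definition power_col i : 'cV[R[i]]_d.+1 := \col_k z i ^+ k.

Definition cmx E : 'M[R[i]]_d.+1 := map_mx intr E.

Definition eigval E i : R[i] := (cmx E *m power_col i) 0 0.

Definition multiplier E := forall i, cmx E *m power_col i = eigval E i *: power_col i.

Lemma power_col0 i : power_col i 0 0 = 1.
Proof. by rewrite mxE expr0. Qed.

Lemma cmxM E F : cmx (E * F) = cmx E *m cmx F.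
Proof. exact: map_mxM. Qed.

Lemma cmx1 : cmx 1 = 1.
Proof. exact: map_mx1. Qed.

Lemma eigval_uniq E i c : cmx E *m power_col i = c *: power_col i -> eigval E i = c.
Proof. by move=> Ec; rewrite /eigval Ec mxE power_col0 mulr1. Qed.

Lemma multiplier_exists E (c : 'I_d.+1 -> R[i]) :
  (forall i, cmx E *m power_col i = c i *: power_col i) -> multiplier E.
Proof. by move=> Ec i; rewrite (eigval_uniq (Ec i)) Ec. Qed.

Lemma row_eigval E k i :
  (map_poly intr (rVpoly (row k E))).[z i] = (cmx E *m power_col i) k 0.
Proof.
have szE : (size (map_poly intr (rVpoly (row k E)) : {poly R[i]}) <= d.+1)%N.
  by rewrite (leq_trans (size_poly _ _)) // size_poly.
rewrite (horner_coef_wide _ szE) mxE; apply: eq_bigr => l _.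
by rewrite coef_map /= coef_rVpoly_ord !mxE.
Qed.

(** Row [k] holds the coordinates of the product of the represented element with alpha^k in the
    basis 1, alpha, ..., alpha^d. Row 0 thus gives the element itself, and the last row will give
    the approximating polynomial. *)
Lemma row_multiplier E k i : multiplier E ->
  (map_poly intr (rVpoly (row k E))).[z i] = eigval E i * z i ^+ k.
Proof. by move=> mE; rewrite row_eigval mE !mxE. Qed.

Lemma multiplierM_aux E F i : multiplier E -> multiplier F ->
  cmx (E * F) *m power_col i = (eigval E i * eigval F i) *: power_col i.
Proof. by move=> mE mF; rewrite cmxM -mulmxA mF -scalemxAr mE scalerA mulrC. Qed.

Lemma multiplierM E F : multiplier E -> multiplier F -> multiplier (E * F).
Proof. by move=> mE mF; apply: multiplier_exists => i; apply: multiplierM_aux. Qed.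

Lemma eigvalM E F i : multiplier E -> multiplier F ->
  eigval (E * F) i = eigval E i * eigval F i.
Proof. by move=> mE mF; apply: eigval_uniq; apply: multiplierM_aux. Qed.

Lemma eigval1 i : eigval 1 i = 1.
Proof. by apply: eigval_uniq; rewrite cmx1 mul1mx scale1r. Qed.

Lemma multiplier1 : multiplier 1.
Proof. by move=> i; rewrite eigval1 cmx1 mul1mx scale1r. Qed.

Lemma multiplierX E m : multiplier E -> multiplier (E ^+ m).
Proof.
move=> mE; elim: m => [|m IHm]; first exact: multiplier1.
by rewrite exprS; apply: multiplierM.
Qed.

Lemma eigvalX E m i : multiplier E -> eigval (E ^+ m) i = eigval E i ^+ m.
Proof.
move=> mE; elim: m => [|m IHm]; first exact: eigval1.
by rewrite !exprS eigvalM ?IHm //; apply: multiplierX.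
Qed.

Lemma eigval_sum (I : finType) (P : pred I) (F : I -> 'M[int]_d.+1) i :
  eigval (\sum_(j | P j) F j) i = \sum_(j | P j) eigval (F j) i.
Proof.
by rewrite /eigval /cmx raddf_sum mulmx_suml summxE.
Qed.

Lemma multiplier_sum (I : finType) (P : pred I) (F : I -> 'M[int]_d.+1) :
  (forall j, P j -> multiplier (F j)) -> multiplier (\sum_(j | P j) F j).
Proof.
move=> mF i; rewrite eigval_sum /cmx raddf_sum mulmx_suml scaler_suml.
by apply: eq_bigr => j Pj; apply: mF.
Qed.

Lemma eigvalZ (a : int) E i : eigval (a *: E) i = a%:~R * eigval E i.
Proof. by rewrite /eigval /cmx map_mxZ /= -scalemxAl mxE. Qed.

Lemma multiplierZ (a : int) E : multiplier E -> multiplier (a *: E).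
Proof. by move=> mE i; rewrite eigvalZ /cmx map_mxZ /= -scalemxAl mE scalerA. Qed.

Lemma eigval_neq0 E i : E \is a GRing.unit -> multiplier E -> eigval E i != 0.
Proof.
move=> uE mE; apply: contra_eq_neq (power_col0 i) => e0.
suff -> : power_col i = 0 by rewrite mxE eq_sym oner_eq0.
rewrite -[LHS]mul1mx -[1%:M]cmx1 -(mulVr uE) cmxM -mulmxA mE e0 scale0r.
by rewrite mulmx0.
Qed.

Lemma multiplierV_aux E i : E \is a GRing.unit -> multiplier E ->
  cmx E^-1 *m power_col i = (eigval E i)^-1 *: power_col i.
Proof.
move=> uE mE; have e0 := eigval_neq0 i uE mE.
apply: (scalerI e0); rewrite scalerA divff // scale1r scalemxAr -mE.
by rewrite mulmxA -cmxM mulVr // cmx1 mul1mx.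
Qed.

Lemma multiplierV E : E \is a GRing.unit -> multiplier E -> multiplier E^-1.
Proof.
by move=> uE mE; apply: multiplier_exists => i; apply: multiplierV_aux.
Qed.

Lemma eigvalV E i : E \is a GRing.unit -> multiplier E ->
  eigval E^-1 i = (eigval E i)^-1.
Proof. by move=> uE mE; apply: eigval_uniq; apply: multiplierV_aux. Qed.

Lemma eigval_quotient E F G i : multiplier E -> multiplier F ->
  E * F = G -> eigval F i != 0 -> eigval E i = eigval G i / eigval F i.
Proof. by move=> mE mF <- F0; rewrite eigvalM // mulfK. Qed.

Lemma mulmx_det_eq0 E F : \det F != 0 -> E * F = 0 -> E = 0.
Proof.
move=> F0 EF0; apply/eqP; have : \det F *: E == 0.
  by rewrite -mul_mx_scalar -mul_mx_adj mulmxA -[E *m F]/(E * F) EF0 mul0mx.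
by rewrite scalemx_eq0 (negPf F0).
Qed.

(* With L = l * det E, the quotient F / E is 1 + l Y adj(E). *)
Lemma quotient_exists E F Y (L : int) : multiplier E -> multiplier F ->
  (forall i, eigval E i != 0) -> \det E != 0 -> (\det E %| L)%Z ->
  F = E + L *: Y -> exists2 U, multiplier U & U * E = F.
Proof.
move=> mE mF e0 E0 /dvdzP[l Ll] defF.
have [U UE] : exists U, U * E = F.
  exists (1 + l *: (Y *m \adj E)); rewrite mulrDl mul1r defF; congr (_ + _).
  transitivity ((l *: (Y *m \adj E)) *m E) => //.
  by rewrite -scalemxAl -mulmxA mul_adj_mx mul_mx_scalar scalerA -Ll.
exists U; last exact: UE.
apply: (multiplier_exists (c := fun i => eigval F i / eigval E i)) => i.
apply: (scalerI (e0 i)); rewrite scalerA [_ * (_ / _)]mulrC divfK; last exact: e0.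
by rewrite -mF -UE cmxM -mulmxA mE -scalemxAr.
Qed.

(** Both determinants divide [L], so both quotients [F / E] and [E / F] are integral; they are
    inverse to each other because [E] can be cancelled. *)
Lemma unit_quotient_exists E F Y (L : int) : multiplier E -> multiplier F ->
  (forall i, eigval E i != 0) -> (forall i, eigval F i != 0) ->
  \det E != 0 -> \det F != 0 ->
  (\det E %| L)%Z -> (\det F %| L)%Z -> F = E + L *: Y ->
  exists U, [/\ multiplier U, U \is a GRing.unit & U * E = F].
Proof.
move=> mE mF e0 f0 E0 F0 EL FL defF.
have defE : E = F + L *: (- Y) by rewrite defF scalerN addrK.
have [U mU UE] := quotient_exists mE mF e0 E0 EL defF.
have [V mV VF] := quotient_exists mF mE f0 F0 FL defE.
exists U; split=> //; have VU : V * U = 1.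
  apply/eqP; rewrite -subr_eq0; apply/eqP; apply: (mulmx_det_eq0 E0).
  by rewrite mulrBl mul1r -mulrA UE VF subrr.
by have := mulmx1_unit VU; case.
Qed.

Hypothesis z_inj : injective z.

(** The Vandermonde matrix of the conjugates diagonalizes all multipliers at once. Hence the
    determinant is the norm, and the eigenvalues determine the matrix. *)
Lemma multiplier_diag E : multiplier E ->
  cmx E *m nodes_mx z = nodes_mx z *m diag_mx (\row_i eigval E i).
Proof.
move=> mE; apply/matrixP => k i.
have := congr1 (fun M : 'cV_d.+1 => M k 0) (mE i).
rewrite [LHS]mxE [RHS]mxE => Ek.
rewrite [RHS]mxE (bigD1 i) //= big1 ?addr0 => [|j neji]; last first.
  by rewrite !mxE (negPf neji) mulr0n mulr0.
rewrite [LHS]mxE !mxE eqxx mulr1n mulrC; apply: etrans (etrans Ek _).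
  by apply: eq_bigr => j _; rewrite !mxE.
by rewrite mxE.
Qed.

Lemma det_multiplier E : multiplier E -> (\det E)%:~R = \prod_i eigval E i.
Proof.
move=> mE; have := congr1 determinant (multiplier_diag mE).
rewrite !det_mulmx mulrC det_map_mx det_diag => /mulfI ->.
  by apply: eq_bigr => i _; rewrite mxE.
by have := nodes_mx_unit z_inj; rewrite unitmxE unitfE.
Qed.

Lemma multiplier_inj E F : multiplier E -> multiplier F ->
  (forall i, eigval E i = eigval F i) -> E = F.
Proof.
move=> mE mF eqEF.
have : cmx E *m nodes_mx z = cmx F *m nodes_mx z.
  rewrite (multiplier_diag mE) (multiplier_diag mF); congr (_ *m diag_mx _).
  by apply/rowP => i; rewrite !mxE.
move=> /(congr1 (mulmx^~ (invmx (nodes_mx z)))).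
have uW := nodes_mx_unit z_inj; rewrite (mulmxK uW) (mulmxK uW) => eqc.
apply/matrixP => k l; move/matrixP/(_ k l): eqc; rewrite [LHS]mxE [RHS]mxE.
by move=> /eqP; rewrite eqr_int => /eqP.
Qed.

(** The rows are polynomials with known values at the [z i], so interpolation bounds their
    coefficients. As the entries are integers, bounded conjugates leave only finitely many
    multipliers. *)
Lemma multiplier_entries_bound : exists2 K : R, 0 < K &
  forall E (M : R), multiplier E -> (forall i, cabs (eigval E i) <= M) ->
    forall k l, `|(E k l)%:~R : R| <= K * M.
Proof.
have [K K0 HK] := interp_bound z_inj.
pose Z := 1 + \sum_i \sum_(k < d.+1) cabs (z i ^+ k).
have Z0 : 0 < Z.
  rewrite ltr_pwDl // sumr_ge0 // => i _.
  by rewrite sumr_ge0 // => k _; apply: cabs_ge0.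
exists (K * Z) => [|E M mE eM k l]; first exact: mulr_gt0.
have szE : (size (map_poly intr (rVpoly (row k E)) : {poly R[i]}) <= d.+1)%N.
  by rewrite (leq_trans (size_poly _ _)) // size_poly.
have M0 : 0 <= M by apply: le_trans (cabs_ge0 _) (eM ord0).
have := HK _ (Z * M) szE _ l; rewrite coef_map /= coef_rVpoly_ord mxE.
rewrite cabs_int intr_norm mulrA; apply => i; rewrite row_multiplier // cabsM mulrC.
apply: ler_pM; rewrite ?cabs_ge0 //.
rewrite /Z ler_wpDl //.
apply: le_trans (ler_term_sum i _) => [|j]; last first.
  by rewrite sumr_ge0 // => *; apply: cabs_ge0.
by apply: (ler_term_sum (F := fun k : 'I_d.+1 => _)) => j; apply: cabs_ge0.
Qed.

End Multipliers.

(** * Units near a ray, and the approximating polynomials *)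

Section NumberField.
Variables (R : realType) (d : nat) (f : {poly int}) (z : 'I_d.+1 -> R[i]).
Hypothesis z_inj : injective z.
Hypothesis size_f : size f = d.+2.
Hypothesis root_f : forall i, root (map_poly intr f) (z i).
Hypothesis min_f : forall (P : {poly int}) i, (size P <= d.+1)%N ->
  root (map_poly intr P) (z i) -> P = 0.

Implicit Types (P : {poly int}) (i : 'I_d.+1) (E F : 'M[int]_d.+1).
Local Notation a := (lead_coef f).

(* Multiplication by [a * alpha], which maps the lattice M to itself. *)
Definition companion : 'M[int]_d.+1 := \matrix_(k, l)
  if (k < d)%N then a *+ (l == k.+1 :> nat) else - f`_l.

(** The first rows shift the powers of [z i]; the last one expresses [a * z i ^ d.+1] by lower
    powers through the equation [f]. *)
Lemma companion_multiplier i :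
  cmx R companion *m power_col z i = (a%:~R * z i) *: power_col z i.
Proof.
apply/colP => k; rewrite !mxE.
have [ltkd|lekd] := ltnP k d.
  have ltk1 : (k.+1 < d.+1)%N by [].
  rewrite (bigD1 (Ordinal ltk1)) //= big1 ?addr0 => [|l nel].
    by rewrite !mxE ltkd eqxx mulr1n /= exprS mulrA.
  rewrite !mxE ltkd; case: eqP => [e|]; last by rewrite mul0r.
  by case/eqP: nel; apply: val_inj.
have -> : k = d :> nat by apply/eqP; rewrite eqn_leq lekd -ltnS ltn_ord.
have /rootP := root_f i.
rewrite (@horner_coef_wide _ d.+2); last by rewrite -size_f size_poly.
rewrite big_ord_recr /= coef_map /= -[f`_d.+1]/(f`_(d.+2.-1)) -size_f => /eqP.
rewrite addr_eq0 -lead_coefE -mulrA -exprS => /eqP e.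
rewrite -[RHS]opprK -e -sumrN; apply: eq_bigr => l _.
by rewrite !mxE ltnNge lekd /= coef_map rmorphN mulNr.
Qed.

(* Multiplication by [a ^ d * P(alpha)]. *)
Definition order_mx (P : {poly int}) : 'M[int]_d.+1 :=
  \sum_(k < d.+1) (P`_k * a ^+ (d - k)) *: companion ^+ k.

Lemma order_mx_multiplier P : multiplier z (order_mx P).
Proof.
apply: multiplier_sum => k _; apply: multiplierZ; apply: multiplierX.
exact: multiplier_exists companion_multiplier.
Qed.

Lemma eigval_order_mx P i : (size P <= d.+1)%N ->
  eigval z (order_mx P) i = a%:~R ^+ d * (map_poly intr P).[z i].
Proof.
move=> szP; rewrite eigval_sum (@horner_coef_wide _ d.+1); last first.
  exact: leq_trans (size_poly _ _) szP.
rewrite mulr_sumr; apply: eq_bigr => k _.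
rewrite eigvalZ eigvalX; last exact: multiplier_exists companion_multiplier.
rewrite (eigval_uniq (companion_multiplier i)) coef_map /= rmorphM rmorphXn /=.
have <- : a%:~R ^+ (d - k) * a%:~R ^+ k = a%:~R ^+ d :> R[i].
  by rewrite -exprD subnK // -ltnS.
by rewrite exprMn mulrCA !mulrA; congr (_ * _); rewrite mulrAC; congr (_ * _); rewrite mulrC.
Qed.

Lemma lead_neq0 : a != 0.
Proof. by rewrite lead_coef_eq0 -size_poly_gt0 size_f. Qed.

Lemma horner_neq0 P i : P != 0 -> (size P <= d.+1)%N ->
  (map_poly intr P).[z i] != 0.
Proof. by move=> P0 szP; apply: contra_neq P0 => /rootP; apply: min_f. Qed.

Lemma det_order_mx P : (size P <= d.+1)%N -> (`|\det (order_mx P)|%:~R : R) =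
  `|a|%:~R ^+ (d * d.+1) * \prod_i cabs (map_poly intr P).[z i].
Proof.
move=> szP; rewrite -cabs_int (det_multiplier z_inj (order_mx_multiplier P)).
rewrite cabs_prod; under eq_bigr => i _.
  by rewrite eigval_order_mx // cabsM cabsX cabs_int; over.
by rewrite big_split prodr_const /= card_ord exprM.
Qed.

Lemma det_order_mx_neq0 P : P != 0 -> (size P <= d.+1)%N ->
  \det (order_mx P) != 0.
Proof.
move=> P0 szP; have := det_order_mx szP.
apply: contra_eqN => /eqP ->; rewrite normr0 eq_sym mulf_neq0 //.
  by rewrite expf_neq0 // intr_eq0 normr_eq0 lead_neq0.
by apply/prodf_neq0 => i _; rewrite cabs_eq0 horner_neq0.
Qed.

(** Up to a fixed power of [a], the product is the absolute value of the determinant of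
    [order_mx P], a nonzero integer. *)
Lemma norm_lower_bound : exists2 c : R, 0 < c &
  forall P, P != 0 -> (size P <= d.+1)%N ->
    c <= \prod_i cabs (map_poly intr P).[z i].
Proof.
have a0 : 0 < `|a|%:~R ^+ (d * d.+1) :> R.
  by rewrite exprn_gt0 // ltr0z normr_gt0 lead_neq0.
exists (`|a|%:~R ^+ (d * d.+1))^-1 => [|P P0 szP]; first by rewrite invr_gt0.
rewrite -[leLHS]mulr1 ler_pdivrMl // -det_order_mx // ler1z.
by rewrite -gtz0_ge1 normr_gt0 det_order_mx_neq0.
Qed.

(** * Dirichlet's box principle and lattice points near the ray *)

Variables (i0 : 'I_d.+1) (alpha : R).
Hypothesis z_i0 : z i0 = alpha%:C%C.

Lemma real_horner (P : {poly int}) :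
  (map_poly intr P).[z i0] = ((map_poly intr P).[alpha])%:C%C.
Proof.
rewrite z_i0 -horner_map -map_poly_comp; congr (_.[_]).
by apply: eq_map_poly => m /=; rewrite rmorph_int.
Qed.

(** The [(N + 1) ^ (d + 1)] polynomials with coefficients between 0 and [N] take values at alpha of
    size less than [S N]. With only [N ^ (d + 1)] cells, two of them share a cell, and their
    difference is as required. *)
Lemma dirichlet_box : exists2 C : R, 0 < C & forall N, (0 < N)%N ->
  exists P : {poly int}, [/\ P != 0, (size P <= d.+1)%N,
    forall i, cabs (map_poly intr P).[z i] <= C * N%:R &
    `|(map_poly intr P).[alpha]| <= C / N%:R ^+ d].
Proof.
pose S := 1 + \sum_i \sum_(k < d.+1) cabs (z i ^+ k).
have S1 i : \sum_(k < d.+1) cabs (z i ^+ k) < S.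
  pose F j := \sum_(k < d.+1) cabs (z j ^+ k).
  rewrite /S; apply: (le_lt_trans (ler_term_sum (F := F) i _)).
    by move=> j; rewrite sumr_ge0 // => *; apply: cabs_ge0.
  by rewrite ltrDr.
have S0 : 0 < S by apply: le_lt_trans (S1 i0); rewrite sumr_ge0 // => *; apply: cabs_ge0.
exists (2 * S) => [|N N0]; first exact: mulr_gt0.
have bound (P : {poly int}) i : (size P <= d.+1)%N ->
    (forall k, (`|P`_k| <= N%:Z)) -> cabs (map_poly intr P).[z i] < S * N%:R.
  move=> szP PN; rewrite (@horner_coef_wide _ d.+1); last first.
    exact: leq_trans (size_poly _ _) szP.
  apply: le_lt_trans (cabs_sum _ _) _.
  have N0' : 0 < N%:R :> R by rewrite ltr0n.
  apply: le_lt_trans (_ : _ <= (\sum_(k < d.+1) cabs (z i ^+ k)) * N%:R) _; last first.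
    by rewrite ltr_pM2r.
  rewrite mulr_suml; apply: ler_sum => k _; rewrite cabsM mulrC.
  rewrite ler_wpM2l ?cabs_ge0 // coef_map /= cabs_int.
  by rewrite -[N%:R]/((N%:Z)%:~R) ler_int.
pose PV (v : {ffun 'I_d.+1 -> 'I_N.+1}) : {poly int} := \poly_(k < d.+1) (v (inord k))%:Z.
have PVk v (k : 'I_d.+1) : (PV v)`_k = v k by rewrite coef_poly ltn_ord inord_val.
have PVb v k : `|(PV v)`_k| <= N%:Z.
  by rewrite coef_poly; case: ifP => // _; rewrite ger0_norm // lez_nat -ltnS.
have PVs v : (size (PV v) <= d.+1)%N by apply: size_poly.
have A v : `|(map_poly intr (PV v)).[alpha]| < S * N%:R.
  by rewrite -cabs_real -real_horner bound.
have M0 : (0 < N ^ d.+1)%N by rewrite expn_gt0 N0.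
pose h v : 'I_(N ^ d.+1) := Ordinal (cell_lt M0 (A v)).
have [|v [v' [nevv' /(congr1 val) /= eqh]]] := exists_collision h.
  by rewrite card_ffun !card_ord ltn_exp2r.
exists (PV v - PV v'); split.
- apply: contra_neq nevv' => /eqP; rewrite subr_eq0 => /eqP eqP'.
  apply/ffunP => k; apply: val_inj; have := PVk v k; rewrite eqP' PVk.
  by case.
- by rewrite (leq_trans (size_polyD _ _)) // size_polyN geq_max !PVs.
- move=> i; rewrite rmorphB hornerD hornerN /=; apply: le_trans (cabsD _ _) _.
  by rewrite cabsN -mulrA mulr2n mulrDl mul1r lerD // ltW // bound.
- rewrite rmorphB hornerD hornerN /=.
  (* A cell has length [2 S N / N ^ (d + 1) = 2 S / N ^ d]. *)
  have := cell_eq M0 (A v) (A v') eqh; move=> /le_trans; apply.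
  have N0' : (N%:R : R) != 0 by rewrite pnatr_eq0 -lt0n.
  by rewrite natrX exprS invfM !mulrA mulfK.
Qed.

(* The weights have product 1, so that upper bounds for all the weighted conjugates
   and a lower bound for the norm give lower bounds for the weighted conjugates. *)
Definition weight (b : R) i : R := if i == i0 then b ^+ d else b^-1.

Lemma weight_gt0 b i : 0 < b -> 0 < weight b i.
Proof. by move=> b0; rewrite /weight; case: ifP; rewrite ?exprn_gt0 ?invr_gt0. Qed.

Lemma weightM b b' i : weight (b * b') i = weight b i * weight b' i.
Proof. by rewrite /weight; case: ifP; rewrite ?exprMn ?invfM. Qed.

Lemma weightV b i : weight b^-1 i = (weight b i)^-1.
Proof. by rewrite /weight; case: ifP; rewrite ?exprVn ?invrK. Qed.

Lemma weightX b n i : weight (b ^+ n) i = weight b i ^+ n.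
Proof. by rewrite /weight; case: ifP; rewrite ?exprVn // exprAC. Qed.

Lemma prod_weight b : 0 < b -> \prod_i weight b i = 1.
Proof.
move=> b0; rewrite (bigD1 i0) //= {1}/weight eqxx.
rewrite (eq_bigr (fun=> b^-1)); last by move=> i /negPf i1; rewrite /weight i1.
by rewrite prodr_const cardC1 card_ord /= exprVn divff // expf_neq0 // gt_eqF.
Qed.

(** Up to the factor [C], the moduli are [b ^ (-d)] at [i0] and [b] elsewhere; these vectors, for
    varying [b], form the ray in logarithmic coordinates. *)
Definition near_ray (C b : R) (y : 'I_d.+1 -> R[i]) :=
  forall i, C^-1 <= cabs (y i) * weight b i <= C.

Lemma near_rayM C b y C' b' y' : 0 < C -> 0 < C' -> 0 < b -> 0 < b' ->
  near_ray C b y -> near_ray C' b' y' ->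
  near_ray (C * C') (b * b') (fun i => y i * y' i).
Proof.
move=> C0 C'0 b0 b'0 Cy Cy' i.
have /andP[l u] := Cy i; have /andP[l' u'] := Cy' i.
have w0 := weight_gt0 i b0; have w'0 := weight_gt0 i b'0.
rewrite cabsM weightM mulrACA invfM.
by rewrite !ler_pM ?invr_ge0 ?mulr_ge0 ?cabs_ge0 ?(ltW C0) ?(ltW C'0) ?(ltW w0) ?(ltW w'0).
Qed.

Lemma near_rayV C b y : 0 < C -> 0 < b -> near_ray C b y ->
  near_ray C b^-1 (fun i => (y i)^-1).
Proof.
move=> C0 b0 Cy i; have /andP[l u] := Cy i.
have p0 : 0 < cabs (y i) * weight b i by apply: lt_le_trans l; rewrite invr_gt0.
rewrite cabsV weightV -invfM lef_pV2 ?posrE // u /=.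
by rewrite -[leRHS]invrK lef_pV2 ?posrE // invr_gt0.
Qed.

Lemma near_ray_le C C' b y : 0 < C -> C <= C' -> near_ray C b y -> near_ray C' b y.
Proof.
move=> C0 CC' Cy i; have /andP[l u] := Cy i.
rewrite (le_trans u CC') andbT; apply: le_trans l.
by rewrite lef_pV2 ?posrE // (lt_le_trans C0).
Qed.

(** Changing the parameter by the factor [b'] multiplies the weighted moduli by numbers between
    [b' ^ (-d)] and [b' ^ d], which are absorbed in the constant. *)
Lemma near_ray_lift C b b' y : 0 < C -> 0 < b -> 1 <= b' -> (0 < d)%N -> near_ray C b y ->
  near_ray (C * b' ^+ d) (b * b') y.
Proof.
move=> C0 b0 b1 d0 Cy i; have /andP[l u] := Cy i.
have b'0 : 0 < b' by apply: lt_le_trans b1.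
rewrite weightM mulrA invfM; have bd1 : 1 <= b' ^+ d by rewrite exprn_ege1.
have bd : b' <= b' ^+ d by rewrite -[leLHS]expr1 ler_weXn2l.
have bdV : b' ^- d <= 1 by rewrite invf_le1 // (lt_le_trans _ bd1).
have /andP[l' u'] : b' ^- d <= weight b' i <= b' ^+ d.
  rewrite /weight; case: ifP => _; first by rewrite lexx andbT (le_trans bdV).
  rewrite lef_pV2 ?posrE ?exprn_gt0 // bd /=; apply: le_trans bd1.
  by rewrite invf_le1.
have p0 : 0 <= cabs (y i) * weight b i by rewrite mulr_ge0 ?cabs_ge0 // ltW // weight_gt0.
by rewrite !ler_pM // ?invr_ge0 ?exprn_ge0 ?(ltW C0) ?(ltW b'0) ?ltW ?weight_gt0.
Qed.

Lemma near_rayX C b y n : 0 < C -> 0 < b -> near_ray C b y ->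
  near_ray (C ^+ n) (b ^+ n) (fun i => y i ^+ n).
Proof.
move=> C0 b0 Cy i; have /andP[l u] := Cy i.
have y0 : 0 <= cabs (y i) * weight b i.
  by rewrite mulr_ge0 ?cabs_ge0 ?(ltW (weight_gt0 _ b0)).
by rewrite cabsX weightX -exprMn -exprVn !lerXn2r ?nnegrE ?invr_ge0 ?(ltW C0).
Qed.

Lemma near_ray_ge1 C b y : 0 < C -> near_ray C b y -> 1 <= C.
Proof.
move=> C0 Cy; have /andP[l u] := Cy i0.
have := le_trans l u; apply: contraTT; rewrite -!ltNge => C1.
by rewrite (lt_trans C1) // invf_gt1.
Qed.

(** Dirichlet's principle with [N = 2 ^ t] bounds all weighted conjugates above; their product is
    the norm, which is bounded below, so each of them is bounded below too. *)
Lemma near_ray_points : exists2 C : R, 0 < C & forall t : nat,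
  exists P : {poly int}, [/\ P != 0, (size P <= d.+1)%N &
    near_ray C (2 ^+ t) (fun i => (map_poly intr P).[z i])].
Proof.
have [C C0 HC] := dirichlet_box; have [c c0 Hc] := norm_lower_bound.
exists (C + C ^+ d / c) => [|t]; first by rewrite addr_gt0 // divr_gt0 // exprn_gt0.
have [|P [P0 szP Pz Pa]] := HC (2 ^ t)%N; first by rewrite expn_gt0.
exists P; split=> // i; pose y i := cabs (map_poly intr P).[z i] * weight (2 ^+ t) i.
have b0 : 0 < 2 ^+ t :> R by rewrite exprn_gt0.
have yC j : 0 <= y j <= C.
  rewrite mulr_ge0 ?cabs_ge0 ?(ltW (weight_gt0 _ b0)) //= /y /weight.
  rewrite natrX in Pz Pa.
  case: eqP => [->|_]; last by rewrite ler_pdivrMr.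
  by rewrite real_horner cabs_real -ler_pdivlMr ?exprn_gt0.
have cy : c <= \prod_j y j by rewrite big_split /= prod_weight // mulr1 Hc.
have := prod_lower_bound i C0 yC cy.
have /andP[_ yi] := yC i; have yC0 : 0 < C ^+ d / c by rewrite divr_gt0 // exprn_gt0.
rewrite -[cabs _ * _]/(y i) => l.
have -> : y i <= C + C ^+ d / c by rewrite (le_trans yi) // lerDl ltW.
rewrite andbT; apply: le_trans l; rewrite -[leRHS]invrK invf_div lef_pV2 ?posrE ?addr_gt0 //.
by rewrite lerDr ltW.
Qed.

(** * From lattice points to units of the order *)

Hypothesis d_gt0 : (0 < d)%N.

Lemma near_ray_orders : exists2 C : R, 0 < C & forall t : nat,
  exists E, [/\ multiplier z E, \det E != 0 & near_ray C (2 ^+ t) (eigval z E)].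
Proof.
have [C C0 HC] := near_ray_points.
have a1 : 1 <= (`|a|%:~R : R) ^+ d.
  by rewrite exprn_ege1 // ler1z -gtz0_ge1 normr_gt0 lead_neq0.
have A0 : 0 < (`|a|%:~R : R) ^+ d by apply: lt_le_trans a1.
exists (`|a|%:~R ^+ d * C) => [|t]; first exact: mulr_gt0.
have [P [P0 szP Pb]] := HC t; exists (order_mx P); split.
- exact: order_mx_multiplier.
- exact: det_order_mx_neq0.
move=> i; rewrite eigval_order_mx // cabsM cabsX cabs_int -mulrA.
have /andP[l u] := Pb i; rewrite ler_pM2l // u andbT invfM.
by rewrite ler_pM ?invr_ge0 ?(ltW A0) ?(ltW C0) // (le_trans _ a1) // invf_le1.
Qed.

Lemma near_ray_neq0 C b y i : 0 < C -> near_ray C b y -> y i != 0.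
Proof.
move=> C0 Cy; have /andP[l _] := Cy i; rewrite -cabs_eq0.
by apply: contraTneq l => ->; rewrite mul0r -ltNge invr_gt0.
Qed.

Lemma near_ray_det C b E : 0 < C -> 0 < b -> multiplier z E ->
  near_ray C b (eigval z E) -> `|\det E|%:~R <= C ^+ d.+1.
Proof.
move=> C0 b0 mE Cy; rewrite -cabs_int (det_multiplier z_inj mE) cabs_prod.
rewrite -[leLHS]mulr1 -[X in _ * X](prod_weight b0) -big_split /=.
rewrite -[d.+1 in leRHS]card_ord -prodr_const; apply: ler_prod => i _.
by rewrite mulr_ge0 ?cabs_ge0 ?(ltW (weight_gt0 _ b0)) //=; case/andP: (Cy i).
Qed.

(** The multipliers near the ray have bounded determinants, hence a common multiple [L] of these.
    Dividing the one of index [t] by one of bounded index in the same class modulo [L] gives a unit,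
    still near the ray. *)
Lemma near_ray_units : exists2 C : R, 0 < C & forall t : nat,
  exists E, [/\ multiplier z E, E \is a GRing.unit & near_ray C (2 ^+ t) (eigval z E)].
Proof.
have [C C0 HC] := near_ray_orders.
have [G HG] := choice HC.
have p2 t : 0 < 2 ^+ t :> R by rewrite exprn_gt0.
have G0 t i : eigval z (G t) i != 0.
  by have [_ _ /near_ray_neq0] := HG t; apply.
have [L L0 detL] : exists2 L : nat, (0 < L)%N & forall t, (\det (G t) %| L%:Z)%Z.
  (* A factorial is a multiple of every nonzero integer up to the bound for the determinants. *)
  exists ((Num.truncn (C ^+ d.+1)).+1)`! => [|t]; first exact: fact_gt0.
  have [mG dG nG] := HG t.
  have := near_ray_det C0 (p2 t) mG nG; rewrite -abszE -[_%:~R]/(_%:R) => le.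
  rewrite dvdzE absz_nat dvdn_fact // lt0n absz_eq0 dG leqW //.
  by rewrite truncn_ge_nat // exprn_ge0 // ltW.
have [m Hm] := finite_representatives (fun t => residue_mx L (G t)).
exists (C * C * (2 ^+ m) ^+ d) => [|t]; first by rewrite !mulr_gt0 // exprn_gt0.
have [t' let'm eqcls] := Hm t.
have [Y defG] := residue_mx_eq L0 eqcls.
have [mG dG nG] := HG t; have [mG' dG' nG'] := HG t'.
have [E [mE uE EG]] := unit_quotient_exists mG' mG (G0 t') (G0 t) dG' dG (detL t') (detL t) defG.
exists E; split=> //.
(* The quotient belongs to the parameter [2 ^ t / 2 ^ t']; since [t' <= m], returning to [2 ^ t]
   costs a bounded factor. *)
have nE : near_ray (C * C) (2 ^+ t * (2 ^+ t')^-1) (eigval z E).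
  have := near_rayM C0 C0 (p2 t) _ nG (near_rayV C0 (p2 t') nG').
  by rewrite invr_gt0 => /(_ (p2 t')) H i; rewrite (eigval_quotient mE mG' EG).
have := near_ray_lift (mulr_gt0 C0 C0) _ _ d_gt0 nE.
move=> /(_ (2 ^+ t')); rewrite mulfVK ?gt_eqF // => H.
have {}H : near_ray (C * C * (2 ^+ t') ^+ d) (2 ^+ t) (eigval z E).
  by apply: H; rewrite ?mulr_gt0 ?invr_gt0 // exprn_ege1 // ler1n.
apply: near_ray_le H; first by rewrite !mulr_gt0 // exprn_gt0.
rewrite ler_wpM2l ?mulr_ge0 ?(ltW C0) //.
by rewrite lerXn2r ?nnegrE ?(ltW (p2 _)) // ler_weXn2l // ler1n.
Qed.

(** * Units of the order as real numbers *)

(** The eigenvalue at [i0] brought back to [R], through row 0 read as a polynomial in alpha. *)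
Definition real_val E : R := (map_poly intr (rVpoly (row 0 E))).[alpha].

Lemma real_valE E : multiplier z E -> (real_val E)%:C%C = eigval z E i0.
Proof. by move=> mE; rewrite -real_horner row_multiplier // expr0 mulr1. Qed.

Lemma real_valM E F : multiplier z E -> multiplier z F ->
  real_val (E * F) = real_val E * real_val F.
Proof.
move=> mE mF; apply: complexI; rewrite rmorphM /= !real_valE ?eigvalM //.
exact: multiplierM.
Qed.

Lemma real_valV E : multiplier z E -> E \is a GRing.unit ->
  real_val E^-1 = (real_val E)^-1.
Proof.
move=> mE uE; apply: complexI; rewrite fmorphV /= !real_valE ?eigvalV //.
exact: multiplierV.
Qed.

Lemma real_valX E m : multiplier z E -> real_val (E ^+ m) = real_val E ^+ m.
Proof.
move=> mE; apply: complexI; rewrite rmorphXn /= !real_valE ?eigvalX //.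
exact: multiplierX.
Qed.

Lemma real_val1 : real_val 1 = 1.
Proof. by apply: complexI; rewrite real_valE ?eigval1 //; apply: multiplier1. Qed.

Lemma real_val_neq0 E : multiplier z E -> E \is a GRing.unit -> real_val E != 0.
Proof.
move=> mE uE; rewrite -(inj_eq (@complexI R)) real_valE //.
exact: eigval_neq0.
Qed.

(** Row 0 is a polynomial of degree at most [d] with prescribed value at alpha, hence determined by
    [min_f]; it in turn determines all the eigenvalues. *)
Lemma real_val_inj E F : multiplier z E -> multiplier z F ->
  real_val E = real_val F -> E = F.
Proof.
move=> mE mF eqEF; apply: (multiplier_inj z_inj mE mF) => i.
have eq0 : rVpoly (row 0 E) = rVpoly (row 0 F).
  apply/eqP; rewrite -subr_eq0; apply/eqP.
  apply: (@min_f _ i0); first by rewrite -linearB size_poly.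
  rewrite rmorphB rootE hornerD hornerN /= !row_multiplier // expr0 !mulr1.
  by rewrite -!real_valE // eqEF subrr.
have e G : multiplier z G -> eigval z G i = (map_poly intr (rVpoly (row 0 G))).[z i].
  by move=> mG; rewrite row_multiplier // expr0 mulr1.
by rewrite !e // eq0.
Qed.

(** The group of the units of O congruent to 1 modulo [q], embedded in [R]; for [q = 1], all the
    units of O. *)
Definition order_unit (q : int) : set R := [set x | exists E,
  [/\ multiplier z E, E \is a GRing.unit, mx_cong1 q E & real_val E = x]].

Lemma order_unit_real_val E : multiplier z E -> E \is a GRing.unit ->
  order_unit 1 (real_val E).
Proof. by exists E; split=> //; exists (E - 1); rewrite scale1r addrC subrK. Qed.

Lemma order_unit_neq0 q x : order_unit q x -> x != 0.
Proof. by move=> [E [mE uE _ <-]]; apply: real_val_neq0. Qed.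

Lemma order_unitM q x y : order_unit q x -> order_unit q y -> order_unit q (x * y).
Proof.
move=> [E [mE uE qE <-]] [F [mF uF qF <-]]; exists (E * F); split.
- exact: multiplierM.
- by rewrite unitrMl.
- exact: mx_cong1M.
- exact: real_valM.
Qed.

Lemma order_unitV q x : order_unit q x -> order_unit q x^-1.
Proof.
move=> [E [mE uE qE <-]]; exists E^-1; split.
- exact: multiplierV.
- by rewrite unitrV.
- exact: mx_cong1V.
- exact: real_valV.
Qed.

Lemma order_unit_1 q : order_unit q 1.
Proof.
exists 1; split; [exact: multiplier1|exact: unitr1|exact: mx_cong1_1|exact: real_val1].
Qed.

Lemma order_unitXz q x (m : int) : order_unit q x -> order_unit q (x ^ m).
Proof.
move=> qx; have qX k : order_unit q (x ^+ k).
  by elim: k => [|k IHk]; [exact: order_unit_1|rewrite exprS; apply: order_unitM].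
by case: m => k; [exact: qX|exact: (order_unitV (qX k.+1))].
Qed.

Lemma order_unit_prod q n (x : 'I_n -> R) :
  (forall j, order_unit q (x j)) -> order_unit q (\prod_j x j).
Proof.
move=> qx; elim/big_ind: _ => //; first exact: order_unit_1.
exact: order_unitM.
Qed.

Lemma order_unit_pow_order (p : nat) x : (0 < p)%N -> order_unit 1 x ->
  exists2 m, (0 < m)%N & forall s, order_unit (p ^ s)%N%:Z (x ^+ (m * p ^ s)).
Proof.
move=> p0 [E [mE uE _ <-]]; have [m m0 Em] := mx_cong1_pow_order p0 uE.
exists m => // s; exists (E ^+ (m * p ^ s)); split.
- exact: multiplierX.
- exact: unitrX.
- exact: Em.
- exact: real_valX.
Qed.

Lemma order_unit_pow_orders (p : nat) n (u : 'I_n -> R) : (0 < p)%N ->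
  (forall j, order_unit 1 (u j)) ->
  exists2 m, (0 < m)%N &
    forall s j, order_unit (p ^ s)%N%:Z (u j ^+ (m * p ^ s)).
Proof.
move=> p0 uu.
have /choice[m Hm] : forall j, exists m, (0 < m)%N /\
    forall s, order_unit (p ^ s)%N%:Z (u j ^+ (m * p ^ s)).
  by move=> j; have [m m0 Hm] := order_unit_pow_order p0 (uu j); exists m.
exists (\prod_j m j)%N => [|s j].
  by rewrite prodn_gt0 // => j; case: (Hm j).
have [_ Hs] := Hm j; rewrite (bigD1 j) //= mulnAC exprM exprnP.
by apply: order_unitXz; exact: Hs.
Qed.

(** The number is an eigenvalue of an integer matrix, hence a root of its monic characteristic
    polynomial. A row of the inverse Vandermonde matrix serves as left eigenvector. *)
Lemma real_val_integral E : multiplier z E -> integralOver (intr : int -> R) (real_val E).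
Proof.
move=> mE; exists (char_poly E); first exact: char_poly_monic.
have inv := nodes_mx_unit z_inj; set W := nodes_mx z in inv.
have WE : invmx W *m cmx R E = diag_mx (\row_i eigval z E i) *m invmx W.
  have EW := multiplier_diag mE; rewrite -/W in EW.
  by rewrite -[LHS]mulmx1 -(mulmxV inv) mulmxA -(mulmxA (invmx W)) EW mulmxA (mulVmx inv) mul1mx.
have : eigenvalue (cmx R E) (eigval z E i0).
  apply/eigenvalueP; exists (row i0 (invmx W)).
    by rewrite -row_mul WE; apply/rowP => l; rewrite mxE mul_diag_mx !mxE.
  apply/eqP => v0; have := congr1 (fun M => row i0 M) (mulVmx inv).
  rewrite row_mul v0 mul0mx => /rowP/(_ i0)/eqP.
  by rewrite !mxE eqxx eq_sym oner_eq0.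
rewrite eigenvalue_root_char /cmx -map_char_poly -real_valE //.
have -> : map_poly intr (char_poly E) =
    map_poly (real_complex R) (map_poly intr (char_poly E)).
  rewrite -map_poly_comp; apply: eq_map_poly => m /=.
  by rewrite rmorph_int.
by rewrite fmorph_root.
Qed.

(** This passage from the order to the ring of integers lets the unit rank bound the number of
    independent units of O. *)
Lemma order_unit_integer_unit x : order_unit 1 x -> integer_units (Qadjoin alpha) x.
Proof.
move=> ux; have Qx y : order_unit 1 y -> ring_of_integers (Qadjoin alpha) y.
  move=> [E [mE uE _ <-]]; split; last exact: real_val_integral.
  exists (map_poly intr (rVpoly (row 0 E))), 1; rewrite rmorph1 hornerC divr1 oner_eq0.
  split=> //; rewrite /real_val -map_poly_comp; congr (_.[_]).
  by apply: eq_map_poly => m /=; rewrite ratr_int.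
split; [exact: order_unit_neq0 ux|exact: Qx|by apply: Qx; apply: order_unitV].
Qed.

(** * The unit rank and the second box principle *)

Variable r : nat.
Hypothesis rank_le : forall n (u : 'I_n -> R),
  (forall j, integer_units (Qadjoin alpha) (u j)) -> mult_independent u -> (n <= r)%N.

(** Quotients of consecutive units near the ray have bounded conjugates, so they lie in a finite
    list. A maximal independent family [u] of units from this list has at most [r] members, and a
    fixed power [N] sends the list, hence every unit of the sequence, into its span. *)
Lemma unit_sequence : exists (C : R) (n N : nat) (u : 'I_n -> R),
  [/\ 0 < C, (n <= r)%N, (0 < N)%N, forall j, order_unit 1 (u j) &
   forall t : nat, exists E, [/\ multiplier z E, E \is a GRing.unit,
     near_ray C ((2 ^+ N) ^+ t) (eigval z E) & mult_span u (real_val E)]].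
Proof.
have [C C0 HC] := near_ray_units.
have [E HE] := choice HC.
have p2 t : 0 < 2 ^+ t :> R by rewrite exprn_gt0.
have [K K0 HK] := multiplier_entries_bound z_inj.
pose B := Num.truncn (K * (C * C * 2)).
have [F HF] := @bounded_mx_finite d B.
have C1 : 1 <= C by have [_ _ /(near_ray_ge1 C0)] := HE 0.
have CC0 : 0 < C * C by rewrite mulr_gt0.
(* For such [b] the weights are at least 1/2, so all conjugates are at most [2 C C] and the entries
   at most [B]. *)
have bounded b G : 1 <= b <= 2 -> multiplier z G ->
    near_ray (C * C) b (eigval z G) -> G \in F.
  move=> /andP[b1 b2] mG nG; have b0 : 0 < b by apply: lt_le_trans b1.
  apply: HF => k l; rewrite -abszE lez_nat truncn_ge_nat ?natr_absz.
    rewrite intr_norm; apply: HK => // i; have /andP[_] := nG i.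
    rewrite -ler_pdivlMr ?weight_gt0 // => /le_trans; apply.
    rewrite ler_pM2l // /weight; case: ifP => _; last by rewrite invrK.
    by rewrite (le_trans (_ : _ <= 1)) ?ler1n // invf_le1 ?exprn_gt0 // exprn_ege1.
  by rewrite !mulr_ge0 // ltW.
pose S t := E t.+1 * (E t)^-1.
have mE t : multiplier z (E t) by case: (HE t).
have uE t : E t \is a GRing.unit by case: (HE t).
have uS t : S t \is a GRing.unit by rewrite unitrMl ?unitrV.
have mS t : multiplier z (S t) by apply: multiplierM => //; apply: multiplierV.
have E0F : E 0 \in F.
  apply: (bounded 1) => //; first by rewrite lexx ler1n.
  have [_ _] := HE 0; rewrite expr0; apply: near_ray_le => //.
  by rewrite ler_peMr // ltW.
have SF t : S t \in F.
  apply: (bounded 2) => //; first by rewrite lexx ler1n.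
  have [_ _ nE] := HE t; have [_ _ nE'] := HE t.+1.
  have := near_rayM C0 C0 (p2 t.+1) _ nE' (near_rayV C0 (p2 t) nE).
  rewrite invr_gt0 => /(_ (p2 t)); rewrite exprS mulfK ?gt_eqF // => H i.
  by rewrite eigvalM ?eigvalV //; apply: multiplierV.
pose FR := [seq real_val G | G <- F & `[< multiplier z G /\ G \is a GRing.unit >]].
have FRu x : x \in FR -> order_unit 1 x.
  move=> /mapP[G]; rewrite mem_filter => /andP[/asboolP[mG uG] _] ->.
  exact: order_unit_real_val.
have FRP G : G \in F -> multiplier z G -> G \is a GRing.unit -> real_val G \in FR.
  by move=> GF mG uG; apply: map_f; rewrite mem_filter GF andbT; apply/asboolP.
have [|n [u [N [uFR indu N0 spu]]]] := @maximal_independent R FR.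
  by move=> x /FRu /order_unit_neq0.
have u0 j : u j != 0 by apply: (@order_unit_neq0 1); apply: FRu.
exists (C ^+ N), n, N, u; split=> [||//|j|t].
- exact: exprn_gt0.
- by apply: (rank_le _ indu) => j; apply: order_unit_integer_unit; apply: FRu.
- by apply: FRu.
exists (E t ^+ N); split.
- exact: multiplierX.
- exact: unitrX.
- have [_ _ nE] := HE t; rewrite exprAC => i; rewrite eigvalX //.
  exact: near_rayX.
rewrite real_valX //; elim: t => [|t IHt]; first exact: spu (FRP _ _ _ _).
have -> : real_val (E t.+1) = real_val (S t) * real_val (E t).
  by rewrite -real_valM // /S divrK.
by rewrite exprMn; apply: mult_spanM => //; apply: spu (FRP _ _ _ _).
Qed.

(** The number of boxes is a constant times [p ^ (s n)] with [n <= r], whence the bound for [ln H].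
    The constant [C] comes before [delta] and [H0], so that [H0] may later be chosen in terms of [C]
    and [delta]. *)
Lemma units_congruent_near_ray (p : nat) : (0 < p)%N -> exists2 C : R, 0 < C &
  forall delta H0 : R, 0 < delta -> exists2 K : R, 0 < K & forall s, exists E (H : R),
    [/\ multiplier z E, mx_cong1 (p ^ s)%N%:Z E, 1 <= H & H0 <= H] /\
    [/\ ln H <= K * (p ^ s)%N%:R ^+ r, cabs (eigval z E i0) <= C / H ^+ d &
      forall i, i != i0 -> cabs (eigval z E i / H%:C%C - 1) <= delta].
Proof.
move=> p0; have [C [n [N [u [C0 ner N0 uu HE]]]]] := unit_sequence.
have [m m0 Hm] := order_unit_pow_orders p0 uu.
exists (C * C) => [|delta H0 delta0]; first exact: mulr_gt0.
(* Keeping only every [B]-th unit makes any quotient of two of them belong to a parameter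
   [H >= b >= H0]. *)
pose B := (Num.truncn H0).+1; pose b : R := (2 ^+ N) ^+ B.
have b1 : 1 < b by rewrite /b -exprM exprn_egt1 ?ltr1n // -lt0n muln_gt0 N0.
have b0 : 0 < b by apply: lt_trans b1.
have H0b : H0 <= b.
  apply: le_trans (ltW (truncnS_gt H0)) _; rewrite -/B /b -exprM -natrX ler_nat.
  by rewrite (leq_trans (ltnW (ltn_expl B (ltnSn 1)))) // leq_exp2l // leq_pmull.
have [E HEt] := choice (fun t => HE (B * t)%N).
have nE t : near_ray C (b ^+ t) (eigval z (E t)).
  by have [_ _ + _] := HEt t; rewrite exprM.
have bt0 t : 0 < b ^+ t by rewrite exprn_gt0.
have /choice[c Hc] : forall t, exists c : 'I_n -> int, real_val (E t) = \prod_j u j ^ c j.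
  by move=> t; have [_ _ _ []] := HEt t => c ->; exists c.
(* [A] exceeds [C] because cells require strict bounds. [M] makes the error [4 A / M] of the two
   coordinates at most [delta / C]. *)
pose A := C + 1; pose M := (Num.truncn (4 * A * C / delta)).+1.
have M0 : (0 < M)%N by [].
pose y t i := eigval z (E t) i / (b ^+ t)%:C%C.
have yE t i : i != i0 -> C^-1 <= cabs (y t i) <= C.
  move=> ni; have := nE t i; rewrite /weight (negPf ni) /y cabsM cabsV cabs_real.
  by rewrite (gtr0_norm (bt0 t)).
pose K := (M * M)%:R ^+ d.+1 * m%:R ^+ n * ln b.
exists (K + 1) => [|s].
  by rewrite ltr_wpDl // /K !mulr_ge0 ?exprn_ge0 // ln_ge0 // ltW.
pose q := (m * p ^ s)%N; have q0 : (0 < q)%N by rewrite muln_gt0 m0 expn_gt0 p0.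
(* The code records the exponents modulo the orders of the u_j modulo p^s, and
   the position of the normalized conjugates on a fixed fine grid. *)
pose code t : {ffun 'I_d.+1 -> 'I_M * 'I_M} * {ffun 'I_n -> 'I_(q.-1.+1)} :=
  ([ffun i => (inord (cell A M (complex.Re (y t i))), inord (cell A M (complex.Im (y t i))))],
   [ffun j => inord `|(c t j %% q%:Z)%Z|%N]).
pose T := ((M * M) ^ d.+1 * q ^ n)%N.
have [t [t' [lt leT /pair_equal_spec[eqcell eqexp]]]] : exists t t',
    [/\ (t < t')%N, (t' <= T)%N & code t = code t'].
  have [|t [t' [ne eqc]]] := @exists_collision 'I_T.+1 _ code.
    by rewrite card_prod !card_ffun card_prod !card_ord prednK.
  case: (ltngtP t t') => [lt|lt|e]; last by case/eqP: ne; apply: val_inj.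
    by exists t, t'; split=> //; rewrite -ltnS.
  by exists t', t; split=> //; rewrite -ltnS.
have mE s' : multiplier z (E s') by case: (HEt s').
have uE s' : E s' \is a GRing.unit by case: (HEt s').
exists (E t' * (E t)^-1), (b ^+ (t' - t)).
have mEV := multiplierV (uE t) (mE t).
have H1 : 1 <= b ^+ (t' - t) by rewrite exprn_ege1 // ltW.
have bt : b ^+ t' = b ^+ (t' - t) * b ^+ t by rewrite -exprD subnK // ltnW.
split; [split=> //|split].
- exact: multiplierM.
(* Equal codes make the exponents of the quotient divisible by [q = m p ^ s], so the quotient is a
   product of units congruent to 1. Injectivity of [real_val] transfers this to its matrix. *)
- have : order_unit (p ^ s)%N%:Z (real_val (E t' * (E t)^-1)).
    rewrite real_valM // real_valV // !Hc -prodfV -big_split /=.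
    apply: order_unit_prod => j.
    have uj0 : u j != 0 by apply: order_unit_neq0 (uu j).
    have /dvdzP[k kq] : (q%:Z %| c t' j - c t j)%Z.
      rewrite -eqz_mod_dvd; apply/eqP; have q0' : q%:Z != 0 by rewrite gt_eqF.
      move/ffunP/(_ j)/(congr1 val): eqexp; rewrite !ffunE /=.
      have lt' (x : int) : (`|(x %% q%:Z)%Z| < q.-1.+1)%N.
        by rewrite prednK // -ltz_nat gez0_abs ?modz_ge0 // ltz_pmod.
      rewrite !inordK // => e.
      by rewrite -[LHS]gez0_abs ?modz_ge0 // -[RHS]gez0_abs ?modz_ge0 // e.
    have -> : u j ^ c t' j * (u j ^ c t j)^-1 = (u j ^+ q) ^ k.
      by rewrite invr_expz -expfzDr // kq mulrC -exprz_exp.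
    exact: order_unitXz.
  move=> [G [mG _ qG eqG]]; suff <- : G = E t' * (E t)^-1 by [].
  by apply: real_val_inj eqG; [exact: mG|exact: multiplierM].
- by rewrite (le_trans H0b) // -[leLHS]expr1 ler_weXn2l ?subn_gt0 // ltW.
- rewrite lnXn // -[_ *+ _]mulr_natl.
  apply: le_trans (_ : _ <= T%:R * ln b) _.
    by rewrite ler_wpM2r ?ln_ge0 ?(ltW b1) // ler_nat (leq_trans (leq_subr _ _)).
  have -> : T%:R = (M * M)%:R ^+ d.+1 * m%:R ^+ n * (p ^ s)%:R ^+ n :> R.
    by rewrite /T /q !(natrM, natrX) [(m%:R * _) ^+ n]exprMn mulrA.
  apply: le_trans (_ : _ <= K * (p ^ s)%:R ^+ r) _.
    rewrite /K [leRHS]mulrAC ler_wpM2r ?ln_ge0 ?(ltW b1) //.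
    by rewrite ler_wpM2l ?mulr_ge0 ?exprn_ge0 // ler_weXn2l // ler1n expn_gt0 p0.
  by rewrite ler_wpM2r ?exprn_ge0 // lerDl.
- have := near_rayM C0 C0 (bt0 t') _ (nE t') (near_rayV C0 (bt0 t) (nE t)) i0.
  rewrite invr_gt0 bt mulfK ?gt_eqF // => /(_ (bt0 t))/andP[_].
  rewrite {1}/weight eqxx -ler_pdivlMr; last by rewrite exprn_gt0 // (lt_le_trans ltr01).
  by rewrite eigvalM // eigvalV.
move=> i ni; have /andP[yt1 yt2] := yE t i ni; have /andP[yt'1 yt'2] := yE t' i ni.
have yt0 : y t i != 0.
  by rewrite -cabs_gt0 (lt_le_trans _ yt1) // invr_gt0.
(* The normalized quotient differs from 1 by [(y t' i - y t i) / y t i]: the numerator is small by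
   the choice of the grid, and the denominator has modulus at least [C^-1]. *)
have -> : eigval z (E t' * (E t)^-1) i / (b ^+ (t' - t))%:C%C - 1 =
    (y t' i - y t i) / y t i.
  rewrite eigvalM // eigvalV // mulrBl divff //; congr (_ - 1).
  have nz : (b ^+ t)%:C%C != 0 by rewrite -cabs_eq0 cabs_real normr_eq0 gt_eqF.
  by rewrite /y bt rmorphM /= invf_div [(_ * (b ^+ t)%:C%C)^-1]invfM !mulrA mulfVK // mulrAC.
rewrite cabsM cabsV ler_pdivrMr ?cabs_gt0 //.
have ltA w : `|complex.Re (y w i)| < A /\ `|complex.Im (y w i)| < A.
  have /andP[_ yw] := yE w i ni; split; apply: le_lt_trans (_ : C < A); rewrite ?ltrDl //.
    exact: le_trans (Re_le_cabs _) yw.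
  exact: le_trans (Im_le_cabs _) yw.
have /pair_equal_spec[eqRe eqIm] : (inord (cell A M (complex.Re (y t i))) : 'I_M,
    inord (cell A M (complex.Im (y t i))) : 'I_M) =
    (inord (cell A M (complex.Re (y t' i))), inord (cell A M (complex.Im (y t' i)))).
  by move/ffunP/(_ i): eqcell; rewrite !ffunE.
have inordE w w' : `|w| < A -> `|w'| < A ->
    inord (cell A M w) = inord (cell A M w') :> 'I_M -> `|w' - w| <= 2 * A / M%:R.
  move=> wA w'A /(congr1 val); rewrite /= !inordK; [|exact: cell_lt|exact: cell_lt].
  by move=> e; apply: cell_eq.
have [At At'] := (ltA t, ltA t').
apply: le_trans (cabs_le_ReIm _) _; rewrite !raddfB /=.
apply: le_trans (lerD (inordE _ _ At.1 At'.1 eqRe) (inordE _ _ At.2 At'.2 eqIm)) _.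
have M4 : 4 * A * C / delta <= M%:R by apply/ltW/truncnS_gt.
have MR0 : 0 < M%:R :> R by rewrite ltr0n.
apply: le_trans (_ : _ <= delta / C) _; last first.
  by rewrite ler_wpM2l // ltW.
rewrite -mulrDl ler_pdivrMr // mulrAC ler_pdivlMr //.
rewrite ler_pdivrMr // in M4; rewrite [leRHS]mulrC.
by apply: le_trans M4; rewrite -mulrDl -natrD.
Qed.

(** * The limit polynomial Q *)

Lemma conj_neq0 i : z i != 0.
Proof.
apply/eqP => zi0; have := @min_f 'X i; rewrite size_polyX ltnS d_gt0 map_polyX rootX zi0 eqxx.
by move=> /(_ isT isT) /eqP; rewrite polyX_eq0.
Qed.

(** The quotient of [f] by [a (X - alpha)]. *)
Definition cofactor_poly : {poly R[i]} := \prod_(i | i != i0) ('X - (z i)%:P).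

Lemma size_cofactor_poly : size cofactor_poly = d.+1.
Proof.
rewrite /cofactor_poly -big_filter size_prod_XsubC -sum1_size big_filter.
by rewrite sum1_card cardC1 card_ord.
Qed.

Lemma cofactor_poly_root i : i != i0 -> cofactor_poly.[z i] = 0.
Proof.
by move=> ni; rewrite horner_prod (bigD1 i) //= hornerXsubC subrr mul0r.
Qed.

Lemma cofactor_poly_neq0 x : (forall i, i != i0 -> x != z i) -> cofactor_poly.[x] != 0.
Proof.
move=> nx; rewrite horner_prod; apply/prodf_neq0 => i ni.
by rewrite hornerXsubC subr_eq0 nx.
Qed.

Lemma factor_f : map_poly intr f = a%:~R *: (('X - (z i0)%:P) * cofactor_poly) :> {poly R[i]}.
Proof.
have inj := @intr_inj R[i].
have -> : a%:~R = lead_coef (map_poly intr f : {poly R[i]}).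
  by rewrite lead_coef_map_inj.
have -> : ('X - (z i0)%:P) * cofactor_poly = \prod_(x <- [seq z i | i : 'I_d.+1]) ('X - x%:P).
  by rewrite big_map big_enum /= (bigD1 i0).
apply: all_roots_prod_XsubC.
- by rewrite size_map_inj_poly // size_f size_map size_enum_ord.
- by apply/allP => x /mapP[i _ ->].
- by rewrite uniq_rootsE map_inj_uniq ?enum_uniq.
Qed.

(* The polynomial Q of degree at most d with Q(z_i) = z_i^d for i != i0 and
   Q(alpha) = 0. *)
Definition limit_poly : {poly R[i]} :=
  'X^d - (z i0 ^+ d / cofactor_poly.[z i0]) *: cofactor_poly.

Lemma cofactor_z0_neq0 : cofactor_poly.[z i0] != 0.
Proof. by apply: cofactor_poly_neq0 => i ni; rewrite (inj_eq z_inj) eq_sym. Qed.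

Lemma size_limit_poly : (size limit_poly <= d.+1)%N.
Proof.
rewrite (leq_trans (size_polyD _ _)) // geq_max size_polyXn leqnn size_polyN /=.
by rewrite (leq_trans (size_scale_leq _ _)) // size_cofactor_poly.
Qed.

Lemma limit_poly_z i : limit_poly.[z i] = if i == i0 then 0 else z i ^+ d.
Proof.
rewrite hornerD hornerN hornerZ hornerXn.
case: eqP => [->|/eqP ni]; first by rewrite divfK ?subrr // cofactor_z0_neq0.
by rewrite (cofactor_poly_root ni) mulr0 subr0.
Qed.

Lemma limit_poly_0 : limit_poly.[0] != 0.
Proof.
rewrite hornerD hornerN hornerZ hornerXn expr0n gtn_eqF //= sub0r oppr_eq0.
rewrite !mulf_neq0 ?invr_eq0 ?cofactor_z0_neq0 ?expf_neq0 ?conj_neq0 //.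
by apply: cofactor_poly_neq0 => i _; rewrite eq_sym conj_neq0.
Qed.

(* A vanishing derivative would make alpha a root of the nonzero integer
   polynomial X f'' - 2 d f', whose degree is only d. *)
Lemma limit_poly_deriv : limit_poly^`().[z i0] != 0.
Proof.
pose g := cofactor_poly; pose x := z i0.
apply/negP => /eqP; rewrite derivB derivZ derivXn hornerD hornerN hornerZ hornerMn hornerXn.
rewrite -/g -/x => e; have g0 : g.[x] != 0 := cofactor_z0_neq0.
have x0 : x != 0 := conj_neq0 i0.
(* Vanishing of [d x ^ (d - 1) - x ^ d g'(x) / g(x)], cleared of denominators. *)
have {}e : x * g^`().[x] = g.[x] *+ d.
  move/eqP: e; rewrite subr_eq0 => /eqP e.
  have xd : x ^+ d = x * x ^+ d.-1 by rewrite -exprS prednK.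
  apply: (mulfI (expf_neq0 d.-1 x0)); rewrite mulrnAr -mulrnAl e.
  by rewrite [RHS]mulrAC divfK // xd mulrA [x ^+ d.-1 * x]mulrC.
pose P := 'X * f^`()^`() - (2 * d)%:Z *: f^`().
have szP : (size P <= d.+1)%N.
  have sz' : (size f^`() <= d.+1)%N by rewrite (leq_trans (size_poly _ _)) // size_f.
  rewrite (leq_trans (size_polyD _ _)) // geq_max size_polyN.
  rewrite (leq_trans (size_scale_leq _ _) sz') andbT.
  rewrite (leq_trans (size_polyMleq _ _)) // size_polyX /=.
  by rewrite ltnS (leq_trans (size_poly _ _)) // -subn1 leq_subLR.
(* Since [f = a (X - x) g], one has [f'(x) = a g(x)] and [f''(x) = 2 a g'(x)]. *)
have Px : root (map_poly intr P) x.
  rewrite rootE /P rmorphB rmorphM /= map_polyX map_polyZ -!deriv_map factor_f.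
  rewrite -/g -/x !derivZ !derivM derivXsubC mul1r derivD derivM derivXsubC mul1r.
  rewrite !hornerE /= subrr !mul0r !addr0 subr_eq0.
  rewrite mulrAC mulrDr e; apply/eqP; rewrite -pmulrn natrM -mulr_natl.
  by ring.
(* The coefficient of [X ^ d] is [d (d + 1) a - 2 d (d + 1) a], which is not zero. *)
have := min_f szP Px => /(congr1 (fun P : {poly int} => P`_d)); rewrite coef0.
rewrite /P coefB coefXM gtn_eqF // coefZ !coef_deriv prednK //.
have -> : f`_d.+1 = a by rewrite lead_coefE size_f.
have /negPf a0 := lead_neq0.
move=> /eqP; rewrite -[_ *+ d]mulr_natl natz -mulrBl mulf_eq0 mulrn_eq0 a0 orbF /=.
by move: d_gt0; lia.
Qed.

(** The values of [P - H Q] at all conjugates are small compared with [H], hence so are its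
    coefficients by interpolation. Nonvanishing of [Q] at 0 and at the nodes, and of [Q'] at alpha,
    therefore passes to [P]. The nodes will serve to bound the divisors of [P]. *)
Lemma approximants (p : nat) : (0 < p)%N ->
  exists (K kappa : R) (node : 'I_d.+1 -> nat),
    [/\ 0 < K, 0 < kappa, injective node & forall s, exists (P : {poly int}) (H : R),
      [/\ (size P <= d.+1)%N, forall k, (k < d)%N -> ((p ^ s)%N %| P`_k)%Z,
         ((p ^ s)%N %| P`_d - 1)%Z, P`_0 != 0 & forall j, P.[(node j)%:Z] != 0] /\
      [/\ 1 <= H, ln H <= K * (p ^ s)%N%:R ^+ r, forall k, `|(P`_k)%:~R| <= K * H,
         `|(map_poly intr P).[alpha]| <= K / H ^+ d &
         kappa * H <= `|(map_poly intr P^`()).[alpha]|]].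
Proof.
move=> p0; pose Q := limit_poly.
have [C C0 HC] := units_congruent_near_ray p0.
have Q0 : Q != 0 by apply: contraNneq limit_poly_0 => Q0; rewrite -/Q Q0 horner0.
have [m Hm] := roots_bounded Q0.
pose node (j : 'I_d.+1) := (m + j)%N.
have node_inj : injective node by move=> j j' /addnI; apply: val_inj.
(* [None] stands for the point 0, treated together with the nodes. *)
pose pt (j : option 'I_d.+1) : nat := if j is Some j then node j else 0.
have Qpt j : 0 < cabs Q.[(pt j)%:R].
  rewrite cabs_gt0; case: j => [j|] /=; last exact: limit_poly_0.
  by rewrite Hm // leq_addr.
have [k1 k10 Hk1] := exists_pos_lower_bound Qpt.
have k20 : 0 < cabs Q^`().[z i0] by rewrite cabs_gt0 limit_poly_deriv.
have [B1 B10 HB1] := horner_points_bound d.+1 (fun j => (pt j)%:R : R[i]).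
have [B2 B20 HB2] := horner_deriv_bound d.+1 (z i0).
have [K1 K10 HK1] := interp_bound z_inj.
have [Z Z0 HZ] := exists_upper_bound (fun i => cabs (z i ^+ d)).
(* Half of the lower bounds for [Q]: the other half absorbs the error, which [delta] makes at most
   [kappa H]. *)
pose kappa := Num.min k1 (cabs Q^`().[z i0]) / 2.
have kap0 : 0 < kappa by rewrite divr_gt0 // lt_min k10.
have BKZ : 0 < (B1 + B2) * (K1 * Z) by rewrite !mulr_gt0 // addr_gt0.
have [delta delta0 deltaE] : exists2 delta, 0 < delta &
    (B1 + B2) * (K1 * (delta * Z)) = kappa.
  exists (kappa / ((B1 + B2) * (K1 * Z))); first by rewrite divr_gt0.
  clearbody kappa; field.
  by rewrite (gt_eqF Z0) (gt_eqF K10) gt_eqF // addr_gt0.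
(* With [H >= C / delta], the conjugate at [i0], at most [C / H ^ d <= C], is at most [delta H] as
   well. *)
have [K2 K20 HK2] := HC delta (C / delta) delta0.
have [q q0 Hq] := @exists_upper_bound R _ (fun k : 'I_d.+1 => cabs Q`_k).
exists (K2 + (K1 * Z * delta + q) + C * Z), kappa, node; split=> //.
  by rewrite !addr_gt0 ?mulr_gt0.
move=> s; have [E [H [[mE qE H1 HH] [lnH e0 ei]]]] := HK2 s.
(* The last row of a matrix congruent to 1 modulo [p ^ s] is congruent to that of the identity, that
   is, to the polynomial [X ^ d]. *)
have [Y defE] := qE; pose P := rVpoly (row ord_max E).
have Pz i : (map_poly intr P).[z i] = eigval z E i * z i ^+ d by rewrite row_multiplier.
have szP : (size P <= d.+1)%N by rewrite size_poly.
have PE k : (k <= d)%N -> P`_k = E ord_max (inord k).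
  by move=> lek; rewrite -[in LHS](inordK (lek : (k < d.+1)%N)) coef_rVpoly_ord mxE.
have H0 : 0 < H by apply: lt_le_trans H1.
pose PC : {poly R[i]} := map_poly intr P; pose D := PC - H%:C%C *: Q.
have szPC : (size PC <= d.+1)%N by rewrite (leq_trans (size_poly _ _)).
have szD : (size D <= d.+1)%N.
  rewrite (leq_trans (size_polyD _ _)) // geq_max szPC size_polyN.
  by rewrite (leq_trans (size_scale_leq _ _)) // size_limit_poly.
have Dz i : cabs D.[z i] <= delta * H * Z.
  rewrite hornerD hornerN hornerZ limit_poly_z Pz; case: eqP => [->|/eqP ni].
    rewrite mulr0 subr0 cabsM ler_pM ?cabs_ge0 //.
    apply: le_trans e0 _; apply: le_trans (_ : _ <= C) _.
      by rewrite ler_pdivrMr ?exprn_gt0 // ler_peMr ?exprn_ege1 // ltW.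
    by rewrite mulrC -ler_pdivrMr.
  rewrite -mulrBl cabsM ler_pM ?cabs_ge0 //.
  have HC0 : H%:C%C != 0 by rewrite -cabs_eq0 cabs_real normr_eq0 gt_eqF.
  have -> : eigval z E i - H%:C%C = (eigval z E i / H%:C%C - 1) * H%:C%C.
    by rewrite mulrBl divfK // mul1r.
  by rewrite cabsM cabs_real (gtr0_norm H0) ler_wpM2r ?(ltW H0) ?ei.
have Dk := HK1 _ _ szD Dz.
have small B : B <= B1 + B2 -> B * (K1 * (delta * H * Z)) <= kappa * H.
  move=> BB; rewrite -deltaE -[delta * H * Z]mulrAC [K1 * _]mulrA [B * _]mulrA.
  apply: ler_wpM2r; [exact: ltW H0|apply: ler_wpM2r => //].
  by rewrite !mulr_ge0 // ltW.
have close (x y w : R[i]) : 2 * kappa <= cabs y -> w = x - H%:C%C * y ->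
    cabs w <= kappa * H -> kappa * H <= cabs x.
  move=> yk wE wk; have : cabs (x - w) <= cabs x + cabs w.
    by rewrite -(cabsN w) cabsD.
  have -> : x - w = H%:C%C * y by rewrite wE opprB addrC subrK.
  rewrite cabsM cabs_real (gtr0_norm H0) => le.
  have := ler_wpM2l (ltW H0) yk.
  by rewrite [H * (2 * _)]mulrCA (mulrC H kappa); lra.
have kap1 : 2 * kappa <= k1 by rewrite /kappa mulrC divfK ?pnatr_eq0 // ge_min lexx.
have kap2 : 2 * kappa <= cabs Q^`().[z i0].
  by rewrite /kappa mulrC divfK ?pnatr_eq0 // ge_min lexx orbT.
have Ppt j : P.[(pt j)%:Z] != 0.
  have : kappa * H <= cabs PC.[(pt j)%:R].
    apply: (close _ Q.[(pt j)%:R] D.[(pt j)%:R]).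
    - exact: le_trans kap1 (Hk1 j).
    - by rewrite hornerD hornerN hornerZ.
    - by apply: le_trans (HB1 _ _ j szD Dk) (small _ _); rewrite lerDl ltW.
  move=> /(lt_le_trans (mulr_gt0 kap0 H0)); rewrite cabs_gt0 -[(pt j)%:R]/((pt j)%:Z%:~R).
  by rewrite horner_map intr_eq0.
exists P, H; split; split=> //.
- move=> k ltkd; rewrite PE ?(ltnW ltkd) // defE !mxE.
  rewrite -val_eqE /= inordK ?(ltn_trans ltkd) // gtn_eqF // add0r.
  by rewrite dvdz_mulr.
- by rewrite PE // defE !mxE -val_eqE /= inordK // eqxx mulr1n [1 + _]addrC addrK dvdz_mulr.
- by have := Ppt None; rewrite /= horner_coef0.
- by move=> j; have := Ppt (Some j).
- apply: le_trans lnH _; rewrite ler_wpM2r ?exprn_ge0 // -!addrA lerDl.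
  by rewrite !addr_ge0 ?mulr_ge0 // ltW.
- move=> k; have [ltkd|lekd] := ltnP k d.+1; last first.
    rewrite nth_default ?(leq_trans szP) // normr0 mulr_ge0 ?(ltW H0) //.
    by rewrite !addr_ge0 ?mulr_ge0 // ltW.
  have qk : cabs Q`_k <= q := Hq (Ordinal ltkd).
  have Dk' := Dk k; have DE : D`_k = (P`_k)%:~R - H%:C%C * Q`_k.
    by rewrite /D coefB coefZ coef_map.
  rewrite DE in Dk'.
  have : cabs ((P`_k)%:~R : R[i]) <= cabs ((P`_k)%:~R - H%:C%C * Q`_k) + cabs (H%:C%C * Q`_k).
    by apply: le_trans (cabsD _ _); rewrite subrK.
  rewrite cabs_int intr_norm => /le_trans; apply.
  rewrite [cabs (H%:C%C * _)]cabsM cabs_real (gtr0_norm H0).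
  apply: le_trans (_ : _ <= K1 * (delta * H * Z) + H * q) _.
    by rewrite lerD // ler_wpM2l // ltW.
  have CZ0 : 0 <= C * Z by rewrite mulr_ge0 // ltW.
  have -> : K1 * (delta * H * Z) + H * q = (K1 * Z * delta + q) * H by ring.
  by rewrite ler_wpM2r ?(ltW H0) //; lra.
- rewrite -cabs_real -real_horner Pz cabsM.
  apply: le_trans (_ : _ <= C / H ^+ d * Z) _.
    by rewrite ler_pM ?cabs_ge0.
  rewrite mulrAC ler_wpM2r ?invr_ge0 ?exprn_ge0 ?(ltW H0) // lerDr.
  by rewrite !addr_ge0 ?mulr_ge0 // ltW.
- rewrite -cabs_real -real_horner -deriv_map.
  apply: (close _ Q^`().[z i0] D^`().[z i0]) => //.
    by rewrite derivD derivN derivZ hornerD hornerN hornerZ.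
  have [_ HD] := HB2 _ _ szD Dk; apply: le_trans HD (small _ _).
  by rewrite lerDr ltW.
Qed.

End NumberField.
(** * Roots of real polynomials *)

Section RealRoots.
Variable R : realType.
Implicit Types (x t c : R) (q : {poly R}).

Lemma power_taylor_bound x (k : nat) : exists2 B : R, 0 <= B & forall t, `|t| <= 1 ->
  `|(x + t) ^+ k - x ^+ k - t * (k%:R * x ^+ k.-1)| <= B * t ^+ 2.
Proof.
elim: k => [|k [B B0 HB]].
  by exists 0 => // t _; rewrite !expr0 subrr !mul0r mulr0 subr0 normr0.
exists (k%:R * `|x| ^+ k.-1 + (`|x| + 1) * B) => [|t t1].
  by rewrite addr_ge0 ?mulr_ge0 ?addr_ge0 ?exprn_ge0.
pose D := (x + t) ^+ k - x ^+ k - t * (k%:R * x ^+ k.-1).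
have -> : (x + t) ^+ k.+1 - x ^+ k.+1 - t * (k.+1%:R * x ^+ k.+1.-1) =
    t ^+ 2 * (k%:R * x ^+ k.-1) + (x + t) * D.
  rewrite /D; case: k {HB D} => [|k] /=; first by rewrite !expr0 expr1; ring.
  by rewrite !exprS -[k.+2%:R]natr1; ring.
apply: le_trans (ler_normD _ _) _; rewrite [leRHS]mulrDl; apply: lerD.
  rewrite normrM (ger0_norm (sqr_ge0 t)) mulrC ler_wpM2r ?sqr_ge0 //.
  by rewrite normrM normrX ger0_norm.
rewrite normrM -[leRHS]mulrA ler_pM ?normr_ge0 //; last exact: HB.
by rewrite (le_trans (ler_normD _ _)) // lerD.
Qed.

Lemma poly_taylor_bound x (n : nat) : exists2 B : R, 0 < B & forall q c t,
  (size q <= n)%N -> (forall k, `|q`_k| <= c) -> `|t| <= 1 ->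
  `|q.[x + t] - q.[x] - t * q^`().[x]| <= B * c * t ^+ 2 /\
  `|q.[x + t] - q.[x]| <= B * c * `|t|.
Proof.
have /choice[Bf HBf] : forall k : 'I_n, exists B : R, 0 <= B /\ forall t, `|t| <= 1 ->
    `|(x + t) ^+ k - x ^+ k - t * (k%:R * x ^+ k.-1)| <= B * t ^+ 2.
  by move=> k; have [B B0 HB] := power_taylor_bound x k; exists B.
pose B1 := \sum_k Bf k; pose B2 := \sum_(k < n) (Bf k + `|k%:R * x ^+ k.-1|).
have B10 : 0 <= B1 by apply: sumr_ge0 => k _; case: (HBf k).
have B20 : 0 <= B2 by apply: sumr_ge0 => k _; rewrite addr_ge0 //; case: (HBf k).
exists (1 + B1 + B2) => [|q c t szq qc t1]; first by rewrite -addrA ltr_pwDl ?addr_ge0.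
have c0 : 0 <= c := le_trans (normr_ge0 _) (qc 0).
have t2 : t ^+ 2 <= `|t|.
  by rewrite -real_normK ?num_real // expr2 ler_piMr.
have dE : q^`().[x] = \sum_(k < n) q`_k * (k%:R * x ^+ k.-1).
  case: n szq {Bf HBf B1 B2 B10 B20} => [|n] szq.
    by move: szq; rewrite leqn0 size_poly_eq0 => /eqP ->; rewrite deriv0 horner0 big_ord0.
  rewrite big_ord_recl mul0r mulr0 add0r (@horner_coef_wide _ n); last first.
    by rewrite (leq_trans (size_poly _ _)) // -ltnS (leq_trans (leqSpred _)) //; case: (size q) szq.
  by apply: eq_bigr => k _; rewrite coef_deriv lift0 -[q`_k.+1 *+ k.+1]mulr_natr mulrA.
have diffE : q.[x + t] - q.[x] = \sum_(k < n) q`_k * ((x + t) ^+ k - x ^+ k).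
  rewrite !(horner_coef_wide _ szq) -sumrB.
  by apply: eq_bigr => k _; rewrite mulrBr.
split.
  rewrite diffE dE mulr_sumr -sumrB; apply: le_trans (ler_norm_sum _ _ _) _.
  apply: le_trans (_ : _ <= B1 * (c * t ^+ 2)) _; last first.
    rewrite -[leRHS]mulrA ler_wpM2r ?(mulr_ge0 c0 (sqr_ge0 t)) //.
    by move: B20; lra.
  rewrite mulr_suml; apply: ler_sum => k _.
  rewrite [t * _]mulrCA -mulrBr normrM [leRHS]mulrCA ler_pM ?normr_ge0 //.
  by case: (HBf k) => _; apply.
rewrite diffE; apply: le_trans (ler_norm_sum _ _ _) _.
apply: le_trans (_ : _ <= B2 * (c * `|t|)) _; last first.
  by rewrite -[leRHS]mulrA ler_wpM2r ?mulr_ge0 //; move: B10; lra.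
rewrite mulr_suml; apply: ler_sum => k _.
rewrite normrM [leRHS]mulrCA ler_pM ?normr_ge0 // mulrDl.
have [Bk0 HBk] := HBf k.
rewrite -[X in `|X|](subrK (t * (k%:R * x ^+ k.-1))); apply: le_trans (ler_normD _ _) _.
rewrite lerD //; last by rewrite normrM mulrC.
by apply: le_trans (HBk _ t1) _; rewrite ler_wpM2l.
Qed.

(** On the interval of radius [t = 2 K / (kappa H ^ (d + 1))] the linear term reaches [2 K / H ^ d],
    enough to dominate both the value at [x] and the quadratic error, each at most [K / H ^ d].
    Hence a change of sign. *)
Lemma root_near x (n d : nat) (K kappa : R) : 0 < K -> 0 < kappa ->
  exists H1 : R, forall q H, (size q <= n)%N -> (forall k, `|q`_k| <= K * H) ->
    kappa * H <= `|q^`().[x]| -> `|q.[x]| <= K / H ^+ d -> 1 <= H -> H1 <= H ->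
    exists2 y, root q y & `|x - y| <= 2 * K / kappa / H ^+ d.+1.
Proof.
move=> K0 kap0; have [B B0 HB] := poly_taylor_bound x n.
(* The first term ensures [t <= 1], the second one the bound for the quadratic error. *)
pose H1 := 2 * K / kappa + 4 * K ^+ 2 * B / kappa ^+ 2.
exists H1 => q H szq qK; wlog d0 : q szq qK / 0 <= q^`().[x] => [wl|].
  have [d0|d0] := leP 0 q^`().[x]; first exact: wl.
  have := wl (- q); rewrite size_polyN derivN !hornerN !normrN => Hq qd qx H1' HH.
  have [||//|//|//|//|y] := Hq szq; first by move=> k; rewrite coefN normrN.
    by rewrite oppr_ge0 ltW.
  by rewrite rootN => rq le; exists y.
rewrite (ger0_norm d0) => qd qx Hge1 HH; have H0 : 0 < H by apply: lt_le_trans Hge1.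
set t := 2 * K / kappa / H ^+ d.+1.
have Hd0 : 0 < H ^+ d by rewrite exprn_gt0.
have t0 : 0 < t by rewrite !divr_gt0 ?mulr_gt0 // exprn_gt0.
have HHd : H <= H ^+ d.+1 by rewrite exprS ler_peMr ?exprn_ege1 // ltW.
have [HA HB'] : 2 * K / kappa <= H ^+ d.+1 /\ 4 * K ^+ 2 * B / kappa ^+ 2 <= H ^+ d.+1.
  have A0 : 0 <= 2 * K / kappa by rewrite divr_ge0 ?mulr_ge0 ?ltW.
  have A1 : 0 <= 4 * K ^+ 2 * B / kappa ^+ 2 by rewrite divr_ge0 ?mulr_ge0 ?exprn_ge0 ?ltW.
  by move: HH; rewrite /H1; lra.
have t1 : `|t| <= 1 by rewrite gtr0_norm // /t ler_pdivrMr ?exprn_gt0 // mul1r.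
have tN : `|- t| <= 1 by rewrite normrN.
have small : B * (K * H) * t ^+ 2 <= K / H ^+ d.
  have -> : B * (K * H) * t ^+ 2 =
      K / H ^+ d * (4 * K ^+ 2 * B / kappa ^+ 2 / H ^+ d.+1).
    rewrite /t [H ^+ d.+1]exprS; move: (H ^+ d) Hd0 => h h0; field.
    by rewrite (gt_eqF h0) (gt_eqF H0) gt_eqF.
  rewrite ler_piMr ?divr_ge0 ?(ltW K0) ?(ltW Hd0) // ler_pdivrMr ?exprn_gt0 //.
  by rewrite mul1r.
have tq : 2 * (K / H ^+ d) <= t * q^`().[x].
  apply: le_trans (_ : _ <= t * (kappa * H)) _; last by rewrite ler_wpM2l // ltW.
  rewrite /t [H ^+ d.+1]exprS le_eqVlt; move: (H ^+ d) Hd0 => h h0.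
  by apply/orP; left; apply/eqP; field; rewrite (gt_eqF h0) (gt_eqF H0) gt_eqF.
have [T1 _] := HB q _ _ szq qK t1; have [T2 _] := HB q _ _ szq qK tN.
rewrite sqrrN mulNr opprK in T2.
have [y /andP[ly uy] ry] : exists2 y, x - t <= y <= x + t & root q y.
  apply: poly_ivt; first by lra.
  move: qx T1 T2; rewrite !ler_norml => /andP[? ?] /andP[? ?] /andP[? ?].
  by apply/andP; split; lra.
by exists y => //; rewrite ler_norml; apply/andP; split; lra.
Qed.

End RealRoots.

(** * Infinite sets by approximation, and low coefficients of a product *)

(** A finite set that avoids [x] stays at a positive distance from it. *)
Lemma infinite_set_approach (R : realType) (A : set R) (x : R) : ~ A x ->
  (forall e : R, 0 < e -> exists2 y, A y & `|x - y| < e) -> infinite_set A.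
Proof.
move=> nAx HA /finite_seqP[s As].
have [e e0 He] : exists2 e : R, 0 < e & forall y, y \in s -> e <= `|x - y|.
  have : forall y, y \in s -> x != y.
    by move=> y ys; apply: contra_notN nAx => /eqP ->; rewrite As.
  elim: s {As} => [|y s IHs] ns; first by exists 1.
  have [|e e0 He] := IHs; first by move=> w ws; apply: ns; rewrite inE ws orbT.
  exists (Num.min e `|x - y|).
    by rewrite lt_min e0 normr_gt0 subr_eq0 ns // inE eqxx.
  move=> w; rewrite inE => /predU1P[->|/He le]; first by rewrite ge_min lexx orbT.
  by rewrite ge_min le.
have [y Ay] := HA e e0; rewrite ltNge He //.
by move: Ay; rewrite As.
Qed.

(** Coefficient [j] of the product expresses [F_j G_0] by the earlier [F_i]; the power of [G_0] in
    front supplies what the induction needs for each of them. *)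
Lemma low_coeff_dvd (F G : {poly int}) (q : int) (d : nat) :
  (forall k, (k < d)%N -> (q %| (F * G)`_k)%Z) ->
  forall j, (j < d)%N -> (q %| G`_0 ^+ j.+1 * F`_j)%Z.
Proof.
move=> qFG j; elim/ltn_ind: j => j IHj ltjd.
have := qFG j ltjd; rewrite coefM big_ord_recr /= subnn => qs.
rewrite exprSr -mulrA [G`_0 * _]mulrC.
have -> : F`_j * G`_0 = (\sum_(i < j) F`_i * G`_(j - i) + F`_j * G`_0)
    - \sum_(i < j) F`_i * G`_(j - i) by rewrite addrAC subrr add0r.
rewrite mulrBr rpredB //; first exact: dvdz_mull.
rewrite mulr_sumr rpred_sum // => i _.
have -> : G`_0 ^+ j = G`_0 ^+ i.+1 * G`_0 ^+ (j - i.+1).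
  by rewrite -exprD subnKC.
have -> : G`_0 ^+ i.+1 * G`_0 ^+ (j - i.+1) * (F`_i * G`_(j - i)) =
    (G`_0 ^+ i.+1 * F`_i) * (G`_0 ^+ (j - i.+1) * G`_(j - i)).
  by rewrite mulrACA.
by rewrite dvdz_mulr // IHj // (ltn_trans _ ltjd).
Qed.

(** * Defining polynomials and conjugates *)

Section DefiningPolynomials.
Variable R : realType.
Implicit Types (x : R) (P F : {poly int}).

Lemma map_ratr_intr (E : numFieldType) P :
  map_poly ratr (map_poly intr P : {poly rat}) = map_poly intr P :> {poly E}.
Proof. by rewrite -map_poly_comp; apply: eq_map_poly => m /=; rewrite ratr_int. Qed.

Lemma size_map_intr (E : numDomainType) P : size (map_poly intr P : {poly E}) = size P.
Proof. by rewrite size_map_inj_poly //; apply: intr_inj. Qed.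

Lemma map_intr_eq0 (E : numDomainType) P : (map_poly intr P == 0 :> {poly E}) = (P == 0).
Proof. by rewrite -!size_poly_eq0 size_map_intr. Qed.

Lemma irreducible_not_root (E : numFieldType) (y : E) F P : 
  irreducible_poly (map_poly intr F : {poly rat}) -> root (map_poly intr F) y ->
  ~~ (F %| P) -> ~~ root (map_poly intr P) y.
Proof.
move=> irrF Fy nFP.
have : coprimep (map_poly intr F : {poly rat}) (map_poly intr P).
  by rewrite irreducible_poly_coprime // dvdp_rat_int.
rewrite -(coprimep_map (ratr : rat -> E)) !map_ratr_intr => /coprimep_root.
by apply.
Qed.

Lemma min_size_root x P : P != 0 -> root (map_poly intr P) x ->
  exists2 F, F != 0 /\ root (map_poly intr F) x &
    forall Q, Q != 0 -> root (map_poly intr Q) x -> (size F <= size Q)%N.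
Proof.
move=> P0 Px.
pose S n := `[< exists Q, [/\ Q != 0, root (map_poly intr Q) x & size Q = n] >].
have exS : exists n, S n by exists (size P); apply/asboolP; exists P.
case: (ex_minnP exS) => n /asboolP[F [F0 Fx szF]] minn.
exists F => // Q Q0 Qx; rewrite szF; apply: minn; apply/asboolP.
by exists Q.
Qed.

(** The primitive part of a nonzero integer polynomial of least degree vanishing at [x] qualifies:
    one of the two factors in a rational factorization vanishes at [x], so it has full degree. *)
Lemma is_defining_poly_exists x P : P != 0 -> root (map_poly intr P) x ->
  is_defining_poly x (defining_poly x).
Proof.
move=> P0 Px; apply: (@xgetPex _ 0 [set P | is_defining_poly x P]).
have [F [F0 Fx] minF] := min_size_root P0 Px.
have c0 : zcontents F != 0 by rewrite zcontents_eq0.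
have rootF : root (map_poly intr (zprimitive F)) x.
  move: Fx; rewrite {1}[F]zpolyEprim map_polyZ rootZ //.
  by rewrite intr_eq0.
have sizeF : size (zprimitive F) = size F by rewrite [in RHS](zpolyEprim F) size_scale.
have min_rat (q : {poly rat}) : q != 0 -> root (map_poly ratr q) x -> (size F <= size q)%N.
  have [Q [m m0 ->]] := rat_poly_scale q => q0 qx.
  have m1 : (m%:~R : rat)^-1 != 0 by rewrite invr_eq0 intr_eq0.
  rewrite size_scale // size_map_intr; apply: minF.
    by apply: contraNneq q0 => ->; rewrite rmorph0 scaler0.
  by move: qx; rewrite map_polyZ rootZ ?fmorph_eq0 // map_ratr_intr.
exists (zprimitive F); split=> //; first by rewrite zcontents_primitive F0.
split=> [|q szq dvq].
  rewrite size_map_intr sizeF ltnNge; apply/negP => /size1_polyC Fc.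
  by move: Fx F0; rewrite Fc map_polyC rootC intr_eq0 polyC_eq0 => ->.
have prim0 : (map_poly intr (zprimitive F) : {poly rat}) != 0.
  by rewrite map_intr_eq0 -size_poly_eq0 sizeF size_poly_eq0.
have /dvdpP[t deft] := dvq; move: (prim0); rewrite deft mulf_eq0 negb_or => /andP[t0 q0].
have : root (map_poly ratr (t * q)) x by rewrite -deft map_ratr_intr.
rewrite rmorphM rootM => /orP[tx|qx].
  have := min_rat _ t0 tx; rewrite -sizeF -(size_map_intr rat) deft size_mul //.
  move: szq q0; rewrite -size_poly_gt0; case: (size q) => [|[|k]] // _ _.
  by rewrite -subn1 !addnS subn1 /= ltnNge leq_addr.
rewrite -deft -dvdp_size_eqp // eqn_leq dvdp_leq //.
by rewrite size_map_intr sizeF min_rat.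
Qed.

(** Divisibility over the rationals gives an integral cofactor because [F] is primitive (Gauss). *)
Lemma defining_poly_dvd x F P : is_defining_poly x F -> root (map_poly intr P) x ->
  exists G, P = F * G.
Proof.
move=> [cF irrF Fx] Px; have : F %| P.
  by apply: contraTT Px; apply: irreducible_not_root.
by case/dvdpP_int => G ->; exists G; rewrite [in RHS](zpolyEprim F) cF scale1r.
Qed.

(** A positive degree excludes the default value 0 of [defining_poly]. *)
Lemma algebraic_defining_poly x (n : nat) : (0 < n)%N -> algebraic_of_degree n x ->
  is_defining_poly x (defining_poly x) /\ size (defining_poly x) = n.+1.
Proof.
move=> n0 [_]; rewrite /alg_degree => deg.
have sz : size (defining_poly x) = n.+1.
  by rewrite -deg prednK // lt0n; apply: contraTneq n0 => sz; rewrite -deg sz.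
split=> //; move: sz; rewrite /defining_poly.
by case: xgetP => // _; rewrite size_poly0.
Qed.

(** An irreducible polynomial in characteristic 0 is separable, so its complex roots are distinct;
    irreducibility also makes it minimal for each of them. *)
Lemma conjugates_exist (n : nat) x F : is_defining_poly x F -> size F = n.+2 ->
  exists (z : 'I_n.+1 -> R[i]) (i0 : 'I_n.+1),
    [/\ injective z, z i0 = x%:C%C, forall i, root (map_poly intr F) (z i) &
      forall P i, (size P <= n.+1)%N -> root (map_poly intr P) (z i) -> P = 0].
Proof.
move=> [_ irrF Fx] szF; pose FC : {poly R[i]} := map_poly intr F.
have F0 : F != 0 by rewrite -size_poly_eq0 szF.
have [rs defF] := closed_field_poly_normal FC.
have FC0 : FC != 0 by rewrite map_intr_eq0.
have uniq_rs : uniq rs.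
  rewrite -separable_prod_XsubC.
  have <- : separable_poly FC = separable_poly (\prod_(w <- rs) ('X - w%:P)).
    apply: eqp_separable; rewrite {1}defF.
    by rewrite eqp_scale // lead_coef_eq0.
  rewrite /FC -map_ratr_intr separable_map separable_poly.unlock.
  rewrite irreducible_poly_coprime //; apply/negP => /dvdp_leq.
  have szd : size (map_poly intr F : {poly rat}) = n.+2 by rewrite size_map_intr.
  have d0 : (map_poly intr F : {poly rat})^`() != 0.
    apply: contraTneq (ltn0Sn n) => d0; have := congr1 (fun q : {poly rat} => q`_n) d0.
    rewrite coef_deriv coef0 => /eqP; rewrite mulrn_eq0 /= -[n.+1]/(n.+2.-1) -szd -lead_coefE.
    by rewrite lead_coef_eq0 map_intr_eq0 (negPf F0).
  by move=> /(_ d0); rewrite leqNgt lt_size_deriv // map_intr_eq0.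
have rs_root w : (w \in rs) = root FC w.
  by rewrite defF rootZ ?lead_coef_eq0 // root_prod_XsubC.
have size_rs : size rs = n.+1.
  have := size_map_intr R[i] F; rewrite -/FC defF size_scale ?lead_coef_eq0 //.
  by rewrite size_prod_XsubC szF => [[]].
have xrs : x%:C%C \in rs.
  rewrite rs_root /FC; have -> : map_poly intr F = map_poly (real_complex R) (map_poly intr F).
    by rewrite -map_poly_comp; apply: eq_map_poly => m /=; rewrite rmorph_int.
  by rewrite fmorph_root.
have ltx : (index x%:C%C rs < n.+1)%N by rewrite -size_rs index_mem.
have root_z (i : 'I_n.+1) : root FC rs`_i by rewrite -rs_root mem_nth // size_rs.
exists (fun i => rs`_i), (Ordinal ltx); split=> //=.
- move=> i j /eqP; rewrite nth_uniq ?size_rs // => /eqP e; exact: val_inj.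
- exact: nth_index.
move=> P i szP Pz; apply/eqP; apply: contraTT Pz => P0.
apply: irreducible_not_root irrF (root_z i) _.
by apply/negP => /dvdp_leq => /(_ P0); rewrite szF leqNgt ltnS szP.
Qed.

End DefiningPolynomials.

(** * p-adic absolute values *)

Section PadicAbsoluteValues.
Variables (R : realType) (p : nat).
Hypothesis p_prime : prime p.

Lemma padic_abs_int_le (m : int) (s : nat) : ((p ^ s)%N %| m)%Z ->
  padic_abs R p m%:~R <= (p%:R ^+ s)^-1.
Proof.
rewrite /padic_abs intr_eq0; case: eqP => [_ _|/eqP m0 pm].
  by rewrite invr_ge0 exprn_ge0.
rewrite denq_int numq_int absz1 logn1 sub0r -exprnN.
have p0 : 0 < p%:R :> R by rewrite ltr0n prime_gt0.
rewrite lef_pV2 ?posrE ?exprn_gt0 // ler_weXn2l ?ler1n ?prime_gt0 //.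
by rewrite -pfactor_dvdn // ?absz_gt0 // -[(p ^ s)%N]absz_nat -dvdzE.
Qed.

Lemma padic_abs_int_coprime (m : int) : ~~ (p %| m)%Z -> padic_abs R p m%:~R = 1.
Proof.
move=> pm; have m0 : m != 0 by apply: contraNneq pm => ->; rewrite dvdz0.
rewrite /padic_abs intr_eq0 (negPf m0) denq_int numq_int absz1 logn1 sub0r.
suff -> : logn p `|m| = 0%N by rewrite oppr0 expr0z.
by apply/eqP; rewrite -leqn0 leqNgt -pfactor_dvdn ?absz_gt0 // expn1.
Qed.

Lemma padic_abs_le (q : rat) (l m : int) (s : nat) : q * l%:~R = m%:~R ->
  ~~ (p %| l)%Z -> ((p ^ s)%N %| m)%Z -> padic_abs R p q <= (p%:R ^+ s)^-1.
Proof.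
move=> qlm pl pm; have [->|q0] := eqVneq q 0.
  by rewrite /padic_abs eqxx invr_ge0 exprn_ge0.
have NlmD : numq q * l = m * denq q.
  by apply/(@intr_inj rat); rewrite !rmorphM /= numqE -qlm mulrAC.
have copl k : coprimez (p ^ k)%N l.
  by rewrite coprimezE absz_nat coprimeXl // prime_coprime.
have pN : ((p ^ s)%N %| numq q)%Z.
  by rewrite -(Gauss_dvdzl _ (copl s)) NlmD dvdz_mulr.
have pD : ~~ (p %| denq q)%Z.
  apply/negP => pD; have : (p %| numq q)%Z.
    by rewrite -[p]expn1 -(Gauss_dvdzl _ (copl 1%N)) expn1 NlmD dvdz_mull.
  rewrite dvdzE => pN'; have := coprime_num_den q.
  rewrite dvdzE in pD; move: pN' pD; rewrite absz_nat => pN' pD.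
  by move=> /eqP cop; have := dvdn_gcd p `|numq q| `|denq q|; rewrite pN' pD cop Euclid_dvd1.
have := padic_abs_int_le pN; rewrite /padic_abs (negPf q0) intr_eq0 numq_eq0 (negPf q0).
rewrite denq_int numq_int absz1 logn1.
suff -> : logn p `|denq q| = 0%N by [].
by apply/eqP; rewrite -leqn0 leqNgt -pfactor_dvdn ?absz_gt0 ?denq_eq0 // expn1.
Qed.

(** As [P_d] is a p-adic unit, [P(x) = 0] bounds [|x|^d] by the maximum of [p^(-s) |x|^k] for
    [k < d]. This excludes [|x| > 1], and the maximum is then at most [p^(-s)]. Since [v] is
    controlled on [K] only, membership in [K] is tracked throughout. *)
Lemma absval_root_le (v : R -> R) (x : R) (P : {poly int}) (d s : nat) : (0 < d)%N ->
  absval_above p (Qadjoin x) v -> root (map_poly intr P) x -> (size P <= d.+1)%N ->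
  (forall k, (k < d)%N -> ((p ^ s)%N %| P`_k)%Z) -> ~~ (p %| P`_d)%Z ->
  v x ^+ d <= (p%:R ^+ s)^-1.
Proof.
move=> d0 [v0 _ vM vD vq] Px szP pP pPd; set K := Qadjoin x in v0 vM vD.
have KP (Q : {poly int}) : K (map_poly intr Q).[x].
  by exists (map_poly intr Q), 1; rewrite map_ratr_intr rmorph1 hornerC oner_eq0 divr1.
have Kx k : K (x ^+ k) by have := KP 'X^k; rewrite map_polyXn hornerXn.
have Kc (c : int) : K c%:~R by have := KP c%:P; rewrite map_polyC hornerC.
have vc (c : int) : v c%:~R = padic_abs R p c%:~R by rewrite -vq ratr_int.
have p1 (e : int) : `|e|%N = 1%N -> ~~ (p %| e)%Z.
  by move=> e1; rewrite dvdzE e1 absz_nat Euclid_dvd1.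
have vx k : v (x ^+ k) = v x ^+ k.
  have v1 : v 1 = 1 := etrans (vc 1) (padic_abs_int_coprime (p1 1 erefl)).
  elim: k => [|k IHk]; first by rewrite expr0.
  by rewrite !exprS vM ?IHk //; have := Kx 1%N; rewrite expr1.
have vxge0 : 0 <= v x by apply: v0; have := Kx 1%N; rewrite expr1.
have vN y : K y -> v (- y) = v y.
  move=> Ky; rewrite -mulN1r vM //; last exact: (Kc (-1)).
  by rewrite (_ : v (- 1) = 1) ?mul1r //; apply: etrans (vc (-1)) (padic_abs_int_coprime (p1 _ _)).
pose S n := \sum_(k < n) (P`_k)%:~R * x ^+ k.
have KS n : K (S n).
  have := KP (\poly_(k < n) P`_k); rewrite (@horner_coef_wide _ n); last first.
    by rewrite (leq_trans (size_poly _ _)) // size_poly.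
  congr K; apply: eq_bigr => k _.
  by rewrite coef_map coef_poly ltn_ord.
have vS B n : 0 <= B -> (forall k, (k < n)%N -> v ((P`_k)%:~R * x ^+ k) <= B) -> v (S n) <= B.
  move=> B0; elim: n => [|n IHn] HB.
    by rewrite /S big_ord0 -[0]/(0%:~R) vc /padic_abs intr_eq0 eqxx.
  rewrite /S big_ord_recr /=; apply: le_trans (vD _ _ (KS n) _) _.
    by have := KP (P`_n *: 'X^n); rewrite map_polyZ map_polyXn hornerZ hornerXn.
  by rewrite ge_max IHn ?HB // => k ltkn; apply: HB; apply: ltnW.
have vxd : v x ^+ d = v (S d).
  have : S d.+1 = 0.
    move/rootP: Px; rewrite (@horner_coef_wide _ d.+1); last first.
      by rewrite (leq_trans (size_poly _ _)).
    by move=> <-; apply: eq_bigr => k _; rewrite coef_map.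
  rewrite /S big_ord_recr /= -/(S d) => /eqP; rewrite addr_eq0 => /eqP ->.
  rewrite vN ?vM ?vc ?padic_abs_int_coprime ?mul1r ?vx //.
  by have := KP (P`_d *: 'X^d); rewrite map_polyZ map_polyXn hornerZ hornerXn.
have ps1 : (p%:R ^+ s)^-1 <= 1 :> R.
  by rewrite invf_le1 ?exprn_gt0 ?exprn_ege1 ?ler1n ?ltr0n ?prime_gt0.
have term k : (k < d)%N -> v ((P`_k)%:~R * x ^+ k) <= (p%:R ^+ s)^-1 * v x ^+ k.
  move=> ltkd; rewrite vM // vx vc ler_wpM2r ?exprn_ge0 //.
  exact: padic_abs_int_le (pP k ltkd).
rewrite vxd; have [v1|v1] := leP (v x) 1.
  apply: vS => [|k ltkd]; first by rewrite invr_ge0 exprn_ge0.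
  apply: le_trans (term k ltkd) _; rewrite ler_piMr ?invr_ge0 ?exprn_ge0 //.
  by rewrite exprn_ile1.
have : v (S d) <= v x ^+ d.-1.
  apply: vS => [|k ltkd]; first by rewrite exprn_ge0.
  apply: le_trans (term k ltkd) _; apply: le_trans (_ : _ <= v x ^+ k) _.
    by rewrite ler_piMl ?exprn_ge0.
  by rewrite ler_weXn2l ?(ltW v1) // -ltnS prednK.
by rewrite -[v (S d)]vxd leNgt ltr_eXn2l // ltn_predL d0.
Qed.

End PadicAbsoluteValues.

Lemma powR_log_bound (R : realType) (l K Q : R) (r d : nat) : (0 < d)%N ->
  0 < l -> 0 < K -> 1 <= Q -> l <= K * Q ^+ r ->
  Q `^ (- d%:R^-1) <= K `^ ((r * d)%:R^-1) * l `^ (- (r * d)%:R^-1).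
Proof.
move=> d0 l0 K0 Q1 lKQ; have Q0 : 0 < Q by apply: lt_le_trans Q1.
set x := (r * d)%:R^-1; have x0 : 0 <= x by rewrite invr_ge0.
have le1 : l `^ x <= K `^ x * (Q ^+ r) `^ x.
  rewrite -powRM ?exprn_ge0 ?(ltW K0) ?(ltW Q0) //.
  by rewrite ge0_ler_powR ?nnegrE ?(ltW l0) // mulr_ge0 ?exprn_ge0 ?ltW.
have le2 : (Q ^+ r) `^ x <= Q `^ (d%:R^-1).
  rewrite -powR_mulrn ?(ltW Q0) // -powRrM ler_powR // /x natrM invfM.
  (* For [r = 0] the inverse is 0 by convention, and the left side is 1. *)
  by have [->|r0] := posnP r; rewrite ?mul0r ?invr_ge0 // mulrA divff ?mul1r // pnatr_eq0 -lt0n.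
have lx0 : 0 < l `^ x by rewrite powR_gt0.
have Qd0 : 0 < Q `^ d%:R^-1 by rewrite powR_gt0.
rewrite !powRN ler_pdivlMr // mulrC ler_pdivrMr //.
by apply: le_trans le1 _; rewrite ler_wpM2l ?powR_ge0.
Qed.

(** * Irreducibility of the approximating polynomials *)

Lemma leq_size_factors (F G : {poly int}) : F * G != 0 ->
  (size F <= size (F * G)%R)%N /\ (size G <= size (F * G)%R)%N.
Proof.
rewrite mulf_eq0 negb_or => /andP[F0 G0]; rewrite size_mul //.
move: F0 G0; rewrite -!size_poly_gt0; case: (size F) => // m _.
by case: (size G) => // k _; rewrite addSn leq_addl addnS ltnS leq_addr.
Qed.

Section RootDegree.
Variables (R : realType) (d : nat) (z : 'I_d.+1 -> R[i]) (i0 : 'I_d.+1) (alpha : R).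
Variables (node : 'I_d.+1 -> nat) (K c : R).
Hypothesis z_inj : injective z.
Hypothesis z_i0 : z i0 = alpha%:C%C.
Hypothesis node_inj : injective node.
Hypothesis K_gt0 : 0 < K.
Hypothesis c_gt0 : 0 < c.
Hypothesis norm_ge : forall P : {poly int}, P != 0 -> (size P <= d.+1)%N ->
  c <= \prod_i cabs (map_poly intr P).[z i].

Lemma map_intr_natr (P : {poly int}) (m : nat) :
  (map_poly intr P).[m%:R] = (P.[m%:Z])%:~R :> R[i].
Proof. by rewrite -[m%:R]/(m%:Z%:~R) horner_map. Qed.

(** At each node [G] takes a nonzero integer value, so [F] is there at most as large as [P];
    interpolation at the nodes concludes. *)
Lemma divisor_coeff_bound : exists2 K' : R, 0 < K' & forall (P F G : {poly int}) (H : R),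
  P = F * G -> (size P <= d.+1)%N -> (forall j, P.[(node j)%:Z] != 0) ->
  (forall k, `|(P`_k)%:~R| <= K * H) -> forall k, `|(F`_k)%:~R| <= K' * H.
Proof.
pose x (j : 'I_d.+1) : R[i] := (node j)%:R.
have x_inj : injective x by move=> j j' /eqP; rewrite eqr_nat => /eqP /node_inj.
have [K1 K10 HK1] := interp_bound x_inj.
have [B B0 HB] := horner_points_bound d.+1 x.
exists (K1 * (B * K)) => [|P F G H PFG szP Pnode Pk k]; first by rewrite !mulr_gt0.
have P0 : P != 0 by apply: contraNneq (Pnode ord0) => ->; rewrite horner0.
have szF : (size F <= d.+1)%N.
  by apply: leq_trans szP; move: P0; rewrite PFG => /leq_size_factors[].
have Fx j : cabs (map_poly intr F).[x j] <= B * (K * H).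
  apply: le_trans (HB (map_poly intr P) (K * H) j _ _); last first.
  - by move=> l; rewrite coef_map cabs_int intr_norm Pk.
  - by rewrite (leq_trans (size_poly _ _)).
  rewrite !map_intr_natr !cabs_int ler_int PFG hornerM normrM ler_peMr //.
  by have := Pnode j; rewrite PFG hornerM mulf_eq0 negb_or => /andP[_]; rewrite -normr_gt0 gtz0_ge1.
have szFC : (size (map_poly intr F : {poly R[i]}) <= d.+1)%N by rewrite (leq_trans (size_poly _ _)).
have := HK1 _ _ szFC Fx k; rewrite coef_map cabs_int intr_norm => /le_trans; apply.
by rewrite !mulrA.
Qed.

(** Since [F] vanishes at [xi], close to alpha, [F(alpha)] is O([H ^ (-d)]): all weighted conjugates
    of [F(alpha)] are bounded above, hence also below by the norm. Those of [P(alpha)] are bounded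
    above, so the conjugates of [G(alpha)] are bounded, and with them the coefficients of [G]. *)
Lemma cofactor_const_bound : exists2 K' : R, 0 < K' &
  forall (P F G : {poly int}) (H xi : R), P = F * G -> (size P <= d.+1)%N ->
  (forall j, P.[(node j)%:Z] != 0) -> 1 <= H ->
  (forall k, `|(P`_k)%:~R| <= K * H) -> `|(map_poly intr P).[alpha]| <= K / H ^+ d ->
  root (map_poly intr F) xi -> `|alpha - xi| <= K / H ^+ d.+1 -> `|alpha - xi| <= 1 ->
  `|(G`_0)%:~R| <= K'.
Proof.
have [KF KF0 HKF] := divisor_coeff_bound.
have [B2 B20 HB2] := horner_points_bound d.+1 z.
have [B3 B30 HB3] := poly_taylor_bound alpha d.+1.
have [K1 K10 HK1] := interp_bound z_inj.
(* [K8] and [K9] bound the weighted conjugates for [F] and [P] from above, and [c'] those for [F]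
   from below. *)
pose K8 := B2 * KF + B3 * KF * K; pose K9 := B2 * K + K; pose c' := c / K8 ^+ d.
have K80 : 0 < K8 by rewrite addr_gt0 // !mulr_gt0.
have c'0 : 0 < c' by rewrite divr_gt0 // exprn_gt0.
exists (K1 * (K9 / c')) => [|P F G H xi PFG szP Pnode H1 Pk Pa Fxi axi axi1].
  by rewrite mulr_gt0 // divr_gt0 // addr_gt0 // mulr_gt0.
have H0 : 0 < H by apply: lt_le_trans H1.
have Hd0 : 0 < H ^+ d by rewrite exprn_gt0.
have P0 : P != 0 by apply: contraNneq (Pnode ord0) => ->; rewrite horner0.
have F0 : F != 0 by apply: contraNneq P0 => F0; rewrite PFG F0 mul0r.
have [szF szG] : (size F <= d.+1)%N /\ (size G <= d.+1)%N.
  by move: P0 szP; rewrite PFG => /leq_size_factors[sF sG] szP; split; apply: leq_trans szP.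
have Fk := HKF P F G H PFG szP Pnode Pk.
have szC (Q : {poly int}) : (size Q <= d.+1)%N -> (size (map_poly intr Q : {poly R[i]}) <= d.+1)%N.
  exact: leq_trans (size_poly _ _).
have coefC (Q : {poly int}) b : (forall k, `|(Q`_k)%:~R| <= b :> R) ->
    forall k, cabs (map_poly intr Q : {poly R[i]})`_k <= b.
  by move=> Qb k; rewrite coef_map cabs_int intr_norm.
have weighted (Q : {poly int}) (b e : R) : (size Q <= d.+1)%N -> 0 < b -> 0 < e ->
    (forall k, `|(Q`_k)%:~R| <= b * H) -> `|(map_poly intr Q).[alpha]| <= e / H ^+ d ->
    forall i, 0 <= cabs (map_poly intr Q).[z i] * weight i0 H i <= B2 * b + e.
  move=> szQ b0 e0 Qk Qa i; rewrite mulr_ge0 ?cabs_ge0 ?(ltW (weight_gt0 _ _ H0)) //=.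
  rewrite /weight; case: eqP => [->|_].
    rewrite (real_horner z_i0) cabs_real -ler_pdivlMr //.
    by apply: le_trans Qa _; rewrite ler_wpM2r ?invr_ge0 ?(ltW Hd0) // lerDr mulr_ge0 ?ltW.
  rewrite ler_pdivrMr //; apply: le_trans (HB2 _ _ i (szC _ szQ) (coefC _ _ Qk)) _.
  by rewrite mulrA ler_wpM2r ?(ltW H0) // lerDl ltW.
have Fa : `|(map_poly intr F).[alpha]| <= B3 * KF * K / H ^+ d.
  have szFR : (size (map_poly intr F : {poly R}) <= d.+1)%N by rewrite (leq_trans (size_poly _ _)).
  have FkR k : `|(map_poly intr F : {poly R})`_k| <= KF * H by rewrite coef_map Fk.
  have xia1 : `|xi - alpha| <= 1 by rewrite distrC.
  have [_] := HB3 _ _ _ szFR FkR xia1.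
  rewrite [alpha + _]addrC subrK (rootP Fxi) sub0r normrN => le.
  apply: le_trans le _; rewrite distrC.
  apply: le_trans (ler_wpM2l _ axi) _; first by rewrite !mulr_ge0 ?ltW.
  by rewrite exprS le_eqVlt; apply/orP; left; apply/eqP; field; rewrite !gt_eqF.
have wF := weighted F KF (B3 * KF * K) szF KF0 (mulr_gt0 (mulr_gt0 B30 KF0) K_gt0) Fk Fa.
have wP := weighted P K K szP K_gt0 K_gt0 Pk Pa.
have cF : c <= \prod_i (cabs (map_poly intr F).[z i] * weight i0 H i).
  by rewrite big_split /= prod_weight // mulr1 norm_ge.
have Gz i : cabs (map_poly intr G).[z i] <= K9 / c'.
  rewrite ler_pdivlMr //; have /andP[_ le] := wP i.
  apply: le_trans le; rewrite PFG rmorphM hornerM cabsM /= [_ * cabs _.[_]]mulrC -mulrA.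
  rewrite ler_wpM2l ?cabs_ge0 //.
  exact: (prod_lower_bound i K80 wF cF).
have := HK1 _ _ (szC _ szG) Gz 0.
by rewrite coef_map cabs_int intr_norm.
Qed.

(** If [F] had degree less than [d], then [p ^ s] would divide a power of [G_0] times the leading
    coefficient of [F], which is prime to [p]. So [p ^ s] would be at most that power of the bounded
    nonzero integer [G_0]. *)
Lemma root_degree : exists L : R, forall (P F G : {poly int}) (H xi : R) (p s : nat),
  P = F * G -> (size P <= d.+1)%N -> (forall j, P.[(node j)%:Z] != 0) -> 1 <= H ->
  (forall k, `|(P`_k)%:~R| <= K * H) -> `|(map_poly intr P).[alpha]| <= K / H ^+ d ->
  root (map_poly intr F) xi -> `|alpha - xi| <= K / H ^+ d.+1 -> `|alpha - xi| <= 1 ->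
  prime p -> (forall k, (k < d)%N -> ((p ^ s)%N %| P`_k)%Z) -> ~~ (p %| P`_d)%Z ->
  P`_0 != 0 -> L < (p ^ s)%:R -> size F = d.+1.
Proof.
have [K' K'0 HK'] := cofactor_const_bound.
exists ((K' + 1) ^+ d) => P F G H xi p s PFG szP Pnode H1 Pk Pa Fxi axi axi1 pp qP pPd Pc ltL.
have Gc := HK' P F G H xi PFG szP Pnode H1 Pk Pa Fxi axi axi1.
have P0 : P != 0 by apply: contraNneq Pc => ->; rewrite coef0.
have F0 : F != 0 by apply: contraNneq P0 => F0; rewrite PFG F0 mul0r.
have szF : (size F <= d.+1)%N.
  by apply: leq_trans szP; move: P0; rewrite PFG => /leq_size_factors[].
apply/eqP; rewrite eqn_leq szF leqNgt; apply: contraTN ltL => ltFd.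
have leadP : lead_coef P = P`_d.
  suff -> : P`_d = P`_(size P).-1 by [].
  congr (_`__); apply/eqP; rewrite eq_sym -eqSS prednK ?size_poly_gt0 // eqn_leq szP.
  by rewrite ltnNge; apply: contra pPd => szP'; rewrite nth_default // dvdz0.
have pF : ~~ (p %| lead_coef F)%Z.
  apply: contra pPd => pF; rewrite -leadP PFG lead_coefM.
  exact: dvdz_mulr.
have szF1 : (size F).-1.+1 = size F by rewrite prednK // size_poly_gt0.
have ltF : ((size F).-1 < d)%N by rewrite szF1 -ltnS.
have := @low_coeff_dvd F G (p ^ s)%N d _ _ ltF; rewrite -PFG => /(_ qP).
rewrite -lead_coefE szF1 Gauss_dvdzl; last first.
  by rewrite coprimezE absz_nat coprimeXl // prime_coprime.
rewrite dvdzE absz_nat abszX => /dvdn_leq; rewrite expn_gt0 absz_gt0.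
have -> /= : G`_0 != 0.
  by apply: contraNneq Pc => G0; rewrite PFG coefM big_ord_recr big_ord0 /= G0 mulr0 addr0.
move=> /(_ isT) le; rewrite -leNgt.
apply: le_trans (_ : _ <= (`|(G`_0)%R| ^ size F)%N%:R) _; first by rewrite ler_nat.
rewrite natrX natr_absz intr_norm; apply: le_trans (_ : _ <= (K' + 1) ^+ size F) _.
  by rewrite lerXn2r ?nnegrE ?normr_ge0 ?addr_ge0 ?(ltW K'0) // (le_trans Gc) // lerDl.
by rewrite ler_weXn2l // lerDr ltW.
Qed.

End RootDegree.

(** * Heights, norms and logarithms of the approximations *)

Lemma poly_height_le (R : realType) (F : {poly int}) (b : R) : 0 <= b ->
  (forall k, `|(F`_k)%:~R| <= b) -> (poly_height F)%:R <= b.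
Proof.
move=> b0 Fb; rewrite -truncn_ge_nat //; apply/bigmax_leqP => k _.
by rewrite truncn_ge_nat // natr_absz intr_norm.
Qed.

Lemma poly_height_gt0 (F : {poly int}) : F != 0 -> (0 < poly_height F)%N.
Proof.
rewrite -size_poly_gt0 => szF; have lt : ((size F).-1 < size F)%N by rewrite prednK.
apply: (@leq_trans `|(F`_(Ordinal lt))%R|%N); last exact: leq_bigmax.
by rewrite absz_gt0 -lead_coefE lead_coef_eq0 -size_poly_gt0.
Qed.

Lemma algebraic_of_degree_defining (R : realType) (x : R) (d : nat) :
  is_defining_poly x (defining_poly x) -> size (defining_poly x) = d.+1 ->
  algebraic_of_degree d x.
Proof.
move=> [_ irr rx] sz; split; last by rewrite /alg_degree sz.
exists (map_poly intr (defining_poly x)); last by rewrite map_ratr_intr.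
by rewrite map_intr_eq0 -size_poly_eq0 sz.
Qed.

Lemma constant_cofactor (F G : {poly int}) (d : nat) :
  size F = d.+1 -> F * G != 0 -> (size (F * G)%R <= d.+1)%N ->
  exists2 g, g != 0 & forall k, (F * G)`_k = F`_k * g.
Proof.
move=> szF; rewrite mulf_eq0 negb_or => /andP[F0 G0].
rewrite size_mul // szF addSn /= -[X in (_ <= X)%N]addn1 leq_add2l => /size1_polyC Gg.
by exists G`_0 => [|k]; [rewrite -polyC_eq0 -Gg|rewrite {1}Gg coefMC].
Qed.

(** [P] is the defining polynomial times a constant [g]. As [g] divides [P_d], it is prime to [p],
    so the divisibility properties of [P_0] and [P_d] pass to the defining polynomial. *)
Lemma Norm_padic_le (R : realType) (x : R) (P G : {poly int}) (p d s : nat) :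
  prime p -> P = defining_poly x * G -> size (defining_poly x) = d.+1 ->
  (size P <= d.+1)%N -> ((p ^ s)%N %| P`_0)%Z -> ~~ (p %| P`_d)%Z ->
  padic_abs R p (Norm x) <= (p%:R ^+ s)^-1.
Proof.
set F := defining_poly x => pp PFG szF szP pP0 pPd.
have P0 : P != 0 by apply: contraNneq pPd => ->; rewrite coef0 dvdz0.
have [g g0 Pk] : exists2 g, g != 0 & forall k, P`_k = F`_k * g.
  by move: P0 szP; rewrite PFG; apply: constant_cofactor.
have pg : ~~ (p %| g)%Z by apply: contra pPd => pg; rewrite Pk dvdz_mull.
apply: (@padic_abs_le _ _ pp _ (lead_coef F) ((-1) ^+ alg_degree x * F`_0)).
- rewrite /Norm -/F divfK; first by rewrite rmorphM rmorphXn rmorphN1.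
  by rewrite intr_eq0 lead_coef_eq0 -size_poly_eq0 szF.
- rewrite lead_coefE szF; apply: contra pPd => pF.
  by rewrite Pk dvdz_mulr.
rewrite dvdz_mull // -(Gauss_dvdzl _ (_ : coprimez _ g)) -?Pk //.
by rewrite coprimezE absz_nat coprimeXl // prime_coprime.
Qed.

Lemma le_powR_of_expr_le (R : realType) (x Q : R) (d : nat) : (0 < d)%N ->
  0 <= x -> 0 < Q -> x ^+ d <= Q^-1 -> x <= Q `^ (- d%:R^-1).
Proof.
move=> d0 x0 Q0 xQ; have d0' : d%:R != 0 :> R by rewrite pnatr_eq0 -lt0n.
have -> : x = (x ^+ d) `^ d%:R^-1.
  by rewrite -powR_mulrn // -powRrM divff // powRr1.
have -> : Q `^ (- d%:R^-1) = Q^-1 `^ d%:R^-1.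
  by rewrite -mulN1r powRrM powRN powRr1 // ltW.
by rewrite ge0_ler_powR ?nnegrE ?invr_ge0 ?exprn_ge0 // ltW.
Qed.

(** Since [b >= 1], the additive constant [ln (3 K)] is absorbed in a multiple of [b]. *)
Lemma ln_height_bound (R : realType) (h H K b : R) : 0 < h -> h <= K * H -> 0 < K ->
  0 < H -> 1 <= b -> ln H <= K * b -> ln (3 * h) <= (`|ln (3 * K)| + K + 1) * b.
Proof.
move=> h0 hKH K0 H0 b1 lnH; have b0 : 0 < b by apply: lt_le_trans b1.
have K30 : 0 < 3 * K by rewrite mulr_gt0.
apply: le_trans (_ : _ <= ln (3 * K * H)) _.
  by rewrite ler_ln ?posrE ?mulr_gt0 // -mulrA ler_pM2l.
move: (3 * K) K30 => a a0; rewrite lnM ?posrE // !mulrDl mul1r -addrA.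
apply: lerD; first by rewrite (le_trans (ler_norm _)) // ler_peMr.
by rewrite (le_trans lnH) // lerDl ltW.
Qed.

(** * Roots of the approximants accumulating at alpha *)

Theorem theorem1 (R : realType) (d : nat) (hd : (0 < d)%N)
  (alpha : R) (halpha : algebraic_of_degree d.+1 alpha)
  (r : nat) (hr : unit_rank (Qadjoin alpha) r)
  (p : nat) (hp : prime p) :
  exists c1 c2 c3 : R,
    [/\ 0 < c1, 0 < c2, 0 < c3 &
      infinite_set [set xi : R |
        [/\ algebraic_of_degree d xi,
            `|alpha - xi| < c1 * (height xi)%:R ^- d.+1,
            (forall v : R -> R, absval_above p (Qadjoin xi) v ->
               v xi < c2 * ln (3 * (height xi)%:R) `^ (- (r * d)%:R^-1)) &
            `|alpha - xi| * Num.min (padic_abs R p (Norm xi)) 1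
              < c3 * (height xi)%:R ^- d.+1
                * ln (3 * (height xi)%:R) `^ (- r%:R^-1)]]].
Proof.
have [defF szF] := algebraic_defining_poly (ltn0Sn d) halpha.
have [z [i0 [z_inj z_i0 root_f min_f]]] := conjugates_exist defF szF.
have p0 := prime_gt0 hp; have [_ rank_le] := hr.
have [K [kappa [node [K0 kap0 node_inj HP]]]] :=
  approximants z_inj szF root_f min_f z_i0 hd rank_le p0.
have [c c0 norm_ge] := norm_lower_bound z_inj szF root_f min_f.
have [H1 Hroot] := root_near alpha d.+1 d K0 kap0.
pose K3 := 2 * K / kappa; have K30 : 0 < K3 by rewrite divr_gt0 ?mulr_gt0.
have KK0 : 0 < K + K3 by rewrite addr_gt0.
have [L HL] := root_degree z_inj z_i0 node_inj KK0 c0 norm_ge.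
pose K4 := `|ln (3 * K)| + K + 1.
have K40 : 0 < K4 by rewrite ltr_wpDl // addr_ge0 // ltW.
pose c1 := K3 * K ^+ d.+1; have c10 : 0 < c1 by rewrite mulr_gt0 ?exprn_gt0.
pose e2 : R := (r * d)%:R^-1; pose e3 : R := r%:R^-1.
(* The added 1 makes the inequalities strict. *)
exists (c1 + 1), (K4 `^ e2 + 1), (c1 * K4 `^ e3 + 1); split.
- by rewrite addr_gt0.
- by rewrite addr_gt0 ?powR_gt0.
- by rewrite addr_gt0 // (mulr_gt0 c10) // powR_gt0.
apply: (@infinite_set_approach _ _ alpha).
  (* Alpha has degree [d + 1], so it is not in the set, and it suffices to approach it. *)
  move=> [[_ deg] _ _ _]; have := halpha.2; rewrite deg.
  by move/eqP; rewrite -[X in X == _]addn0 -addn1 eqn_add2l.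
move=> e ee0.
(* Since [q <= K H], the choice [q > T] forces [H] beyond [H1], [K3] and [K3 / e], and [q] itself
   beyond [L]. *)
pose T := K * (`|H1| + K3 + K3 / e) + `|L|.
pose s := (Num.truncn T).+1; pose q := (p ^ s)%N.
have Tq : T < q%:R.
  apply: lt_le_trans (truncnS_gt T) _; rewrite ler_nat /q.
  by rewrite ltnW // ltn_expl // prime_gt1.
have [P [H [[szP pP pPd Pc Pnode] [Hge1 lnH Pk Pa Pd]]]] := HP s.
have H0 : 0 < H by apply: lt_le_trans Hge1.
have q1 : 1 <= q%:R :> R by rewrite ler1n expn_gt0 p0.
(* [q] divides the nonzero constant coefficient of [P]. *)
have qKH : q%:R <= K * H.
  apply: le_trans (Pk 0); rewrite -intr_norm -natr_absz ler_nat dvdn_leq ?absz_gt0 //.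
  by have := pP 0 hd; rewrite dvdzE absz_nat.
have [HH1 HK3 He Lq] : [/\ H1 <= H, K3 <= H, K3 / e < H & L < q%:R].
  have L0 := normr_ge0 L; have H10 := normr_ge0 H1.
  have Ke0 : 0 < K3 / e by rewrite divr_gt0.
  have sumH : `|H1| + K3 + K3 / e < H.
    by rewrite -(ltr_pM2l K0); apply: lt_le_trans qKH; apply: le_lt_trans Tq; rewrite lerDl.
  have sum0 : 0 <= K * (`|H1| + K3 + K3 / e).
    by rewrite mulr_ge0 ?addr_ge0 // ltW.
  split.
  - apply: le_trans (ler_norm H1) (le_trans _ (ltW sumH)).
    by rewrite -addrA lerDl addr_ge0 // ltW.
  - by apply: le_trans (ltW sumH); rewrite addrAC lerDr addr_ge0 // ltW.
  - by apply: le_lt_trans sumH; rewrite lerDr addr_ge0 // ltW.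
  - by apply: le_lt_trans (ler_norm L) (le_lt_trans _ Tq); rewrite lerDr.
have pPd' : ~~ (p %| P`_d)%Z.
  apply/negP => pPd1; have : (p %| 1)%Z.
    have -> : 1 = P`_d - (P`_d - 1) :> int by rewrite opprB addrC subrK.
    by rewrite rpredB // (dvdz_trans _ pPd) // dvdzE !absz_nat /q expnS dvdn_mulr.
  by rewrite dvdzE absz_nat Euclid_dvd1.
pose PR : {poly R} := map_poly intr P.
have szPR : (size PR <= d.+1)%N by rewrite (leq_trans (size_poly _ _)).
have PRk k : `|PR`_k| <= K * H by rewrite coef_map Pk.
have PRd : kappa * H <= `|PR^`().[alpha]| by rewrite deriv_map.
have [xi Pxi axi] := Hroot PR H szPR PRk PRd Pa Hge1 HH1; rewrite -/K3 in axi.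
have HHd : H <= H ^+ d.+1 by rewrite exprS ler_peMr ?exprn_ege1 // ltW.
have Hd0 : 0 < H ^+ d.+1 by rewrite exprn_gt0.
have axi1 : `|alpha - xi| <= 1.
  by apply: le_trans axi _; rewrite ler_pdivrMr // mul1r (le_trans HK3).
have P0 : P != 0 by apply: contraNneq Pc => ->; rewrite coef0.
have defxi := is_defining_poly_exists P0 Pxi.
have [G PFG] := defining_poly_dvd defxi Pxi.
have [_ _ Fxi] := defxi.
have szFxi : size (defining_poly xi) = d.+1.
  apply: (HL P (defining_poly xi) G H xi p s) => //.
  - by move=> k; rewrite (le_trans (Pk k)) // ler_wpM2r ?(ltW H0) // lerDl ltW.
  - by apply: le_trans Pa _; rewrite ler_wpM2r ?invr_ge0 ?exprn_ge0 ?(ltW H0) // lerDl ltW.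
  - by apply: le_trans axi _; rewrite ler_wpM2r ?invr_ge0 ?(ltW Hd0) // lerDr ltW.
have F0 : defining_poly xi != 0 by rewrite -size_poly_eq0 szFxi.
have hgt0 : 0 < (height xi)%:R :> R by rewrite ltr0n poly_height_gt0.
(* [P] is a nonzero integer multiple of the defining polynomial of [xi], which therefore has
   coefficients no larger. *)
have hKH : (height xi)%:R <= K * H.
  apply: poly_height_le => [|k]; first by rewrite mulr_ge0 // ltW.
  have [g g0 Fk] : exists2 g, g != 0 & forall k, P`_k = (defining_poly xi)`_k * g.
    by move: P0 szP; rewrite PFG; apply: constant_cofactor.
  apply: le_trans (Pk k); rewrite -!intr_norm ler_int Fk normrM ler_peMr //.
  by rewrite -gtz0_ge1 normr_gt0.
have h1 : 1 <= (height xi)%:R :> R by rewrite ler1n -(ltr0n R).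
have lnh0 : 0 < ln (3 * (height xi)%:R) :> R.
  by rewrite ln_gt0 // (@lt_le_trans _ _ 3) ?ltr1n // ler_peMr.
have qr1 : 1 <= q%:R ^+ r :> R by rewrite exprn_ege1.
have lnh : ln (3 * (height xi)%:R) <= K4 * q%:R ^+ r.
  exact: ln_height_bound lnH.
have axih : `|alpha - xi| <= c1 * (height xi)%:R ^- d.+1.
  have -> : c1 * (height xi)%:R ^- d.+1 = K3 * (K ^+ d.+1 / (height xi)%:R ^+ d.+1).
    by rewrite mulrA.
  apply: le_trans axi _; rewrite ler_wpM2l ?(ltW K30) //.
  rewrite ler_pdivlMr ?exprn_gt0 // mulrC ler_pdivrMr // -exprMn.
  by rewrite lerXn2r ?nnegrE ?(ltW hgt0) ?mulr_ge0 ?(ltW K0) ?(ltW H0).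
have hd0 : 0 < (height xi)%:R ^- d.+1 :> R by rewrite invr_gt0 exprn_gt0.
exists xi; last first.
  apply: le_lt_trans axi _; rewrite ltr_pdivrMr // mulrC -ltr_pdivrMr //.
  exact: lt_le_trans He HHd.
split.
- exact: algebraic_of_degree_defining.
- by apply: le_lt_trans axih _; rewrite ltr_pM2r // ltrDl.
- move=> v Hv.
  have vd := absval_root_le hp hd Hv Pxi szP pP pPd'.
  have v0 : 0 <= v xi.
    case: Hv => + _ _ _ _; apply; exists 'X, 1.
    by rewrite map_polyX hornerX rmorph1 hornerC oner_eq0 divr1.
  rewrite -natrX -/q in vd.
  apply: le_lt_trans (le_powR_of_expr_le hd v0 _ vd) _; first exact: lt_le_trans q1.
  apply: le_lt_trans (powR_log_bound hd lnh0 K40 q1 lnh) _.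
  by rewrite ltr_pM2r ?powR_gt0 // ltrDl.
have padic := Norm_padic_le hp PFG szFxi szP (pP 0 hd) pPd'.
(* The case [d = 1]: it bounds [q ^ (-1)], hence the p-adic absolute value of the norm, by a power
   of the logarithm with exponent [-1/r]. *)
have bound := powR_log_bound (ltn0Sn 0) lnh0 K40 q1 lnh.
rewrite muln1 invr1 powRN powRr1 ?(le_trans ler01) // in bound.
rewrite -natrX -/q in padic.
have pos : 0 <= K4 `^ e3 * ln (3 * (height xi)%:R) `^ (- e3).
  by rewrite mulr_ge0 ?powR_ge0.
apply: le_lt_trans (_ : _ <= c1 * (height xi)%:R ^- d.+1 *
    (K4 `^ e3 * ln (3 * (height xi)%:R) `^ (- e3))) _.
  apply: le_trans (ler_wpM2r pos axih); rewrite ler_wpM2l //.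
  apply: le_trans bound; apply: le_trans padic.
  by rewrite ge_min lexx.
rewrite mulrA ltr_pM2r ?powR_gt0 // mulrAC ltr_pM2r //.
by rewrite ltrDl.
Qed.
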